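(* Consider $\min_{x\in\mathbb R^{d_x}}F(x):=\frac1n\sum_{i=1}^nf_i(x)$, where each (possibly nonconvex) $f_i:\mathbb R^{d_x}\to\mathbb R$ is bounded below and $L_{f,1}$-smooth (has $L_{f,1}$-Lipschitz gradient), over the time-varying directed network described in the context. Let $\underline\eta>0$, fix initial points $(x_i^0)_{i=1}^n$, and let the step sizes satisfy $\underline\eta\le\eta_x^k\le\eta_{\rm up}$ for all $k\ge0$, where $\eta_{\rm up}$ is the explicit constant defined in the context. Then there is a constant $C>0$ independent of $K$ (it may depend on the functions, the network and matrix sequences, the initial points and $\underline\eta$) such that for every integer $K\ge2$ the sequence generated by the Push–Pull algorithm satisfies $$\min_{0\le k<K-1}\|\nabla F(\bar x^k)\|^2\le C(ab)^{-n}K^{-1},\qquad \min_{0\le k<K-1}\frac1n\sum_{i=1}^n\|x_i^k-\bar x^k\|^2\le C(ab)^{-n}K^{-1},$$ where $\bar x^k=\frac1n\sum_{i=1}^nx_i^k$.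
   Context: **Network.** $n\ge2$ agents, $[n]=\{1,\dots,n\}$. For each $k\ge0$, $\mathcal G^k=([n],\mathcal E^k)$ is a strongly connected directed graph with in/out-neighbor sets $\mathcal N^k_{i,\rm in},\mathcal N^k_{i,\rm out}$. $A^k=[a^k_{ij}]$ is nonnegative row-stochastic with $a^k_{ij}>0$ iff $j\in\mathcal N^k_{i,\rm in}\cup\{i\}$; $B^k=[b^k_{ij}]$ is nonnegative column-stochastic with $b^k_{ji}>0$ iff $j\in\mathcal N^k_{i,\rm out}\cup\{i\}$. There are $a,b>0$ such that all nonzero entries satisfy $a^k_{ij}\ge a$, $b^k_{ij}\ge b$ for all $k$. **Push–Pull algorithm.** $t_{x,i}^0=\nabla f_i(x_i^0)$ and, for $k\ge0$, $i\in[n]$, $$x_i^{k+1}=\sum_ja^k_{ij}x_j^k-\eta_x^kt_{x,i}^k,\qquad t_{x,i}^{k+1}=\sum_jb^k_{ij}t_{x,j}^k+\nabla f_i(x_i^{k+1})-\nabla f_i(x_i^k).$$ **Constants.** For a vector $v$, $\min(v),\max(v)$ denote its smallest/largest entry. $\{\alpha_k\}_{k\ge0}$ and $\{\beta_k\}_{k\ge0}$ are sequences of stochastic vectors (nonnegative entries with sum 1) with $\alpha_{k+1}^\top A^k=\alpha_k^\top$, $\beta_{k+1}=B^k\beta_k$, and, for all $k,i$, $$\tfrac{\underline\alpha}{n}\le[\alpha_k]_i\le\tfrac{\overline\alpha}{n}\le1,\quad \tfrac{\underline\beta}{n}\le[\beta_k]_i\le\tfrac{\overline\beta}{n}\le1,\qquad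 \underline\alpha:=a^n,\ \underline\beta:=b^n .$$ (Such sequences exist.) For a strongly connected digraph $\mathcal G$, $\mathrm D(\mathcal G)$ is its diameter. A shortest-path covering $\mathcal P$ of $\mathcal G$ is a choice, for each ordered pair of distinct nodes, of one shortest directed path from the first to the second; $K(\mathcal P)$ is the maximum over edges of the number of paths in $\mathcal P$ containing that edge; $\mathrm K(\mathcal G)$ is the maximum of $K(\mathcal P)$ over all such coverings. Set $$c_k=\frac{\min(\alpha_{k+1})a^2}{\max^2(\alpha_k)\mathrm D(\mathcal G^k)\mathrm K(\mathcal G^k)},\qquad e_k=\frac{\min^2(\beta_k)b^2}{\max^2(\beta_k)\max(\beta_{k+1})\mathrm D(\mathcal G^k)\mathrm K(\mathcal G^k)},$$ $\underline c=\inf_kc_k$, $\underline e=\inf_ke_k$, $\gamma=\sup_k\big(n+\frac1{\min(\beta_{k+1})}\big)$, $\mathcal C_{s,1}=\dfrac{\underline\beta\,\underline c}{32\,\overline\alpha\,\overline\beta\,n^3}$. The step-size bound $\eta_{\rm up}$ is the minimum of the following eight numbers: $$\frac1{\overline\alpha\overline\beta L_{f,1}},\quad \frac{\mathcal C_{s,1}\underline c\,\underline e\,n}{384\gamma L_{f,1}^2},\quad \sqrt{\frac{\mathcal C_{s,1}\underline c\,\underline\alpha\,\underline\beta}{48L_{f,1}^2}},\quad \sqrt{\frac{\mathcal C_{s,1}\underline c}{192L_{f,1}^2\big(\mathcal C_{s,1}\frac2{\underline c}\overline\beta+\frac{12\gamma L_{f,1}^2}{\underline e}\big)}},$$ $$\frac{\underline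 e\,\underline\alpha\,\underline\beta}{12},\quad \frac{\underline\alpha\,\underline\beta}{16n^2\big(\mathcal C_{s,1}\frac2{\underline c}n\underline\beta+\frac{12\gamma L_{f,1}^2}{\underline e}\big)},\quad \frac{\underline e\,\underline\alpha\,\underline\beta}{384\gamma L_{f,1}^2n^2},\quad \frac{\mathcal C_{s,1}n\underline c}{4L_{f,1}^2}.$$ *)

(* Defs.v *)
From mathcomp Require Import all_boot all_order all_algebra.
From mathcomp Require Import all_classical all_reals all_analysis.

Set Implicit Arguments.
Unset Strict Implicit.
Unset Printing Implicit Defensive.

Import Order.TTheory GRing.Theory Num.Theory.
Import numFieldNormedType.Exports.

Local Open Scope classical_set_scope.
Local Open Scope ring_scope.

(* Smallest and largest entries of a nonempty list or vector; on an empty one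
   both are 0. *)
Definition seq_min (R : realType) (s : seq R) : R :=
  \big[Num.min/head 0 s]_(y <- s) y.

Definition seq_max (R : realType) (s : seq R) : R :=
  \big[Num.max/head 0 s]_(y <- s) y.

Definition vmin (R : realType) (n : nat) (v : 'cV[R]_n) : R :=
  seq_min [seq v i 0 | i <- enum 'I_n].

Definition vmax (R : realType) (n : nat) (v : 'cV[R]_n) : R :=
  seq_max [seq v i 0 | i <- enum 'I_n].

(* The norm that the library puts on 'rV[R]_d is the sup norm, so the Euclidean
   norm is introduced separately. *)
Definition enorm (R : realType) (d : nat) (v : 'rV[R]_d) : R :=
  Num.sqrt (\sum_(j < d) v 0 j ^+ 2).

Definition grad (R : realType) (d : nat) (f : 'rV[R]_d -> R) (x : 'rV[R]_d) :
    'rV[R]_d :=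
  \row_(j < d) 'D_(delta_mx 0 j) f x.

Definition smooth (R : realType) (d : nat) (L : R) (f : 'rV[R]_d -> R) : Prop :=
  (forall x, differentiable f x) /\
  (forall x y, enorm (grad f x - grad f y) <= L * enorm (x - y)).

Definition bounded_below (R : realType) (d : nat) (f : 'rV[R]_d -> R) : Prop :=
  exists m : R, forall x, m <= f x.

(* A digraph is a relation e on a finite type, e x y meaning that there is an
   edge from x to y. Self-loops are permitted; they lie on no shortest path. *)
Definition strongly_connected (T : finType) (e : rel T) : Prop :=
  forall x y, connect e x y.

(* p is the list of vertices that follow x on a directed path from x to y; the
   length of the path is size p. *)
Definition dipath (T : finType) (e : rel T) (x y : T) (p : seq T) : bool :=
  path e x p && (last x p == y).

(* When y is reachable from x, a shortest path has length less than #|T|; the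
   value is #|T| when y is not reachable. *)
Definition distance (T : finType) (e : rel T) (x y : T) : nat :=
  find (fun m => [exists p : m.-tuple T, dipath e x y p]) (iota 0 #|T|).

Definition diameter (T : finType) (e : rel T) : nat :=
  \max_(xy : T * T) distance e xy.1 xy.2.

Definition on_path (T : finType) (x : T) (p : seq T) (uv : T * T) : bool :=
  uv \in zip (x :: p) p.

(* The bound #|T| on the length of the chosen paths excludes no shortest path,
   and makes the type of coverings finite. The values at pairs (x, x) are
   unconstrained and are not counted in covering_load. *)
Definition covering (T : finType) : finType := {ffun T * T -> #|T|.-bseq T}.

Definition is_covering (T : finType) (e : rel T) (P : covering T) : bool :=
  [forall xy : T * T, (xy.1 != xy.2) ==>
     dipath e xy.1 xy.2 (P xy) && (size (P xy) == distance e xy.1 xy.2)].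

Definition covering_load (T : finType) (e : rel T) (P : covering T) : nat :=
  \max_(uv : T * T | e uv.1 uv.2)
    #|[set xy : T * T | (xy.1 != xy.2) && on_path xy.1 (P xy) uv]|.

Definition max_load (T : finType) (e : rel T) : nat :=
  \max_(P : covering T | is_covering e P) covering_load e P.

Definition nonneg_mx (R : realType) (m n : nat) (M : 'M[R]_(m, n)) : Prop :=
  forall i j, 0 <= M i j.

Definition row_stochastic (R : realType) (n : nat) (M : 'M[R]_n) : Prop :=
  nonneg_mx M /\ forall i, \sum_j M i j = 1.

Definition col_stochastic (R : realType) (n : nat) (M : 'M[R]_n) : Prop :=
  nonneg_mx M /\ forall j, \sum_i M i j = 1.

Definition stochastic_vector (R : realType) (n : nat) (v : 'cV[R]_n) : Prop :=
  nonneg_mx v /\ \sum_i v i 0 = 1.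

(* G j i is an edge from j to i, that is, j is an in-neighbor of i and i is an
   out-neighbor of j. *)
Definition row_compatible (R : realType) (n : nat) (G : rel 'I_n) (a : R)
    (A : 'M[R]_n) : Prop :=
  [/\ row_stochastic A,
      forall i j, (0 < A i j) = G j i || (j == i)
    & forall i j, A i j != 0 -> a <= A i j].

Definition col_compatible (R : realType) (n : nat) (G : rel 'I_n) (b : R)
    (B : 'M[R]_n) : Prop :=
  [/\ col_stochastic B,
      forall i j, (0 < B j i) = G i j || (j == i)
    & forall i j, B i j != 0 -> b <= B i j].

Definition average (R : realType) (n d : nat) (x : 'I_n -> 'rV[R]_d) :
    'rV[R]_d :=
  n%:R^-1 *: \sum_(i < n) x i.

Definition objective (R : realType) (n d : nat) (f : 'I_n -> 'rV[R]_d -> R)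
    (x : 'rV[R]_d) : R :=
  n%:R^-1 * \sum_(i < n) f i x.

Definition consensus_error (R : realType) (n d : nat) (x : 'I_n -> 'rV[R]_d) :
    R :=
  n%:R^-1 * \sum_(i < n) enorm (x i - average x) ^+ 2.

Definition push_pull (R : realType) (n d : nat) (f : 'I_n -> 'rV[R]_d -> R)
    (A B : nat -> 'M[R]_n) (eta : nat -> R) (x0 : 'I_n -> 'rV[R]_d)
    (x t : nat -> 'I_n -> 'rV[R]_d) : Prop :=
  [/\ forall i, x 0%N i = x0 i,
      forall i, t 0%N i = grad (f i) (x0 i),
      forall k i, x k.+1 i = \sum_(j < n) A k i j *: x k j - eta k *: t k i
    & forall k i, t k.+1 i =
        \sum_(j < n) B k i j *: t k j
        + grad (f i) (x k.+1 i) - grad (f i) (x k i)].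

Definition ck (R : realType) (n : nat) (G : nat -> rel 'I_n) (a : R)
    (alpha : nat -> 'cV[R]_n) (k : nat) : R :=
  vmin (alpha k.+1) * a ^+ 2
  / (vmax (alpha k) ^+ 2 * (diameter (G k))%:R * (max_load (G k))%:R).

Definition ek (R : realType) (n : nat) (G : nat -> rel 'I_n) (b : R)
    (beta : nat -> 'cV[R]_n) (k : nat) : R :=
  vmin (beta k) ^+ 2 * b ^+ 2
  / (vmax (beta k) ^+ 2 * vmax (beta k.+1)
     * (diameter (G k))%:R * (max_load (G k))%:R).

Definition c_inf (R : realType) (n : nat) (G : nat -> rel 'I_n) (a : R)
    (alpha : nat -> 'cV[R]_n) : R :=
  inf (range (ck G a alpha)).

Definition e_inf (R : realType) (n : nat) (G : nat -> rel 'I_n) (b : R)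
    (beta : nat -> 'cV[R]_n) : R :=
  inf (range (ek G b beta)).

Definition gamma_sup (R : realType) (n : nat) (beta : nat -> 'cV[R]_n) : R :=
  sup (range (fun k : nat => n%:R + 1 / vmin (beta k.+1))).

Definition Cs1 (R : realType) (n : nat) (blow aup bup c : R) : R :=
  (blow * c) / (32 * aup * bup * n%:R ^+ 3).

(* alow, blow, aup, bup are the constants written with under- and overlined
   alpha and beta; c, e, g are c_inf, e_inf and gamma_sup. *)
Definition eta_bound (R : realType) (n : nat)
    (L alow blow aup bup c e g : R) : R :=
  let C := Cs1 n blow aup bup c in
  seq_min [::
    1 / (aup * bup * L);
    (C * c * e * n%:R) / (384 * g * L ^+ 2);
    Num.sqrt ((C * c * alow * blow) / (48 * L ^+ 2));
    Num.sqrt ((C * c) /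
      (192 * L ^+ 2 * (C * (2 / c) * bup + 12 * g * L ^+ 2 / e)));
    (e * alow * blow) / 12;
    (alow * blow) /
      (16 * n%:R ^+ 2 * (C * (2 / c) * n%:R * blow + 12 * g * L ^+ 2 / e));
    (e * alow * blow) / (384 * g * L ^+ 2 * n%:R ^+ 2);
    (C * n%:R * c) / (4 * L ^+ 2)].

Definition eta_up (R : realType) (n : nat) (G : nat -> rel 'I_n)
    (alpha beta : nat -> 'cV[R]_n) (L a b aup bup : R) : R :=
  eta_bound n L (a ^+ n) (b ^+ n) aup bup
    (c_inf G a alpha) (e_inf G b beta) (gamma_sup beta).

(* Main.v *)
(* The weighted mean xh = sum_i [alpha_k]_i x_i moves only by - eta times the
   alpha-average of the trackers t_i, so the descent lemma controls F(xh) up to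
   the dispersion V of the x_i (weights alpha_k) and the dispersion S of the
   t_i / [beta_k]_i (weights beta_k). Both dispersions contract, at rates c_k and
   e_k, by a Poincare inequality on the graph: differences along pairs of nodes
   are routed along a shortest-path covering. With H = eta_up, the function
     F(xh) + c / (2 a^n n e) V + 4 aup H / (n^2 e) S
   then decreases at each step by a multiple of |grad F(xh)|^2 + V. The sums of
   these quantities over all steps are therefore bounded, which gives the rate
   1/K for their minima; V also bounds the distance from xh to the plain average. *)

Require Import Defs.
From mathcomp Require Import all_boot all_order all_algebra.
From mathcomp Require Import all_classical all_reals all_analysis.
From mathcomp Require Import ring lra.
Import Order.TTheory GRing.Theory Num.Theory.
Import numFieldNormedType.Exports.
Local Open Scope classical_set_scope.
Local Open Scope ring_scope.

(** The obstacle is that neither mixing is doubly stochastic: plain means are not preserved, and the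
    weights of those that are change with [k]. Since [alpha] obeys a backward recursion, the mean
    with weights [alpha k.+1] after mixing by [A k] is the mean with weights [alpha k] before it.
    Dividing the trackers by [beta] turns [B k] into a row-stochastic matrix that relates
    [beta k.+1] to [beta k] in the same way, so one abstract contraction serves both sides. The
    direction of descent is the [alpha k.+1]-mean of the trackers. It equals [p] times their sum,
    [p] being the inner product of [alpha k.+1] and [beta k], plus an error measured by [S]; the
    lower bound [a ^+ n / n] on [p] keeps the descent uniform. The weight of [S] in the Lyapunov
    function contains the bound [H] instead of the current step size, so that one function serves
    all steps. Positivity of the infima [c_inf] and [e_inf] is not computed from the network: it is
    read off from the existence of a positive step size below [eta_up]. *)

(** * Weighted variances of real families *)

Lemma wsum_sqr_affine {R : realFieldType} {I : finType} (w z : I -> R) (a b : R) :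
  \sum_i w i * (a * z i - b) ^+ 2 =
  a ^+ 2 * (\sum_i w i * z i ^+ 2) - 2 * a * b * (\sum_i w i * z i)
  + b ^+ 2 * \sum_i w i.
Proof.
rewrite !mulr_sumr -sumrB -big_split /=.
by apply: eq_bigr => i _; ring.
Qed.

(** Cauchy-Schwarz, from the nonnegative sum of [w i * (W * z i - s) ^+ 2]. The weights are not
    normalised because later totals include [1 - w i], [p] and the number of nodes. *)
Lemma sqr_wsum_le {R : realFieldType} {I : finType} (w z : I -> R) :
  (forall i, 0 <= w i) ->
  (\sum_i w i * z i) ^+ 2 <= (\sum_i w i) * \sum_i w i * z i ^+ 2.
Proof.
move=> w0; set W := \sum_i w i; set s := \sum_i w i * z i.
have W0 : 0 <= W by apply: sumr_ge0.
have [W_eq0|Wn0] := eqVneq W 0.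
  have w_eq0 i : w i = 0.
    by apply/eqP; move/eqP: W_eq0; rewrite psumr_eq0 // => /allP /(_ i);
      rewrite mem_index_enum => /(_ isT).
  by rewrite /s big1 ?W_eq0 ?expr0n ?mul0r // => i _; rewrite w_eq0 mul0r.
have Wp : 0 < W by rewrite lt_neqAle eq_sym Wn0.
have : 0 <= \sum_i w i * (W * z i - s) ^+ 2.
  by apply: sumr_ge0 => i _; rewrite mulr_ge0 // sqr_ge0.
have -> : \sum_i w i * (W * z i - s) ^+ 2
    = W * (W * (\sum_i w i * z i ^+ 2) - s ^+ 2).
  by rewrite wsum_sqr_affine -/W -/s; ring.
by rewrite pmulr_rge0 // subr_ge0.
Qed.

Lemma wvariance_shift {R : realFieldType} {I : finType} (w z : I -> R) (c : R) :
  \sum_i w i = 1 ->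
  \sum_i w i * (z i - c) ^+ 2 =
  \sum_i w i * (z i - \sum_j w j * z j) ^+ 2 + (\sum_j w j * z j - c) ^+ 2.
Proof.
move=> w1; set m := \sum_j w j * z j.
transitivity (\sum_i w i * (z i - m) ^+ 2 + 2 * (m - c) * (m - m * \sum_i w i)
              + (m - c) ^+ 2 * \sum_i w i).
  rewrite {3}/m !mulr_sumr -sumrB mulr_sumr -!big_split /=.
  by apply: eq_bigr => i _; ring.
by rewrite w1; ring.
Qed.

(** The variance is [Q - (m - z i) ^+ 2], with [Q] the second moment about [z i]. In [m - z i], a
    weighted sum of the differences [z j - z i], the term of [i] vanishes, so Cauchy-Schwarz costs
    only the weight [1 - w i] and leaves [w i * Q]. *)
Lemma wvariance_ge_edges {R : realFieldType} {I : finType} (w z : I -> R) (i : I) :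
  (forall j, 0 <= w j) -> \sum_j w j = 1 ->
  \sum_j w j * w i * (z j - z i) ^+ 2
    <= \sum_j w j * (z j - \sum_l w l * z l) ^+ 2.
Proof.
move=> w0 w1; have := wvariance_shift w z (z i) w1.
set m := \sum_l w l * z l; set Q := \sum_j w j * _ ^+ 2 => shiftE.
have -> : \sum_j w j * w i * (z j - z i) ^+ 2 = w i * Q.
  by rewrite mulr_sumr; apply: eq_bigr => j _; ring.
suff : (m - z i) ^+ 2 <= (1 - w i) * Q by nra.
have mE : m - z i = \sum_j (if j == i then 0 else w j) * (z j - z i).
  transitivity (\sum_j w j * (z j - z i)).
    under [RHS]eq_bigr => j _ do rewrite mulrBr.
    by rewrite sumrB -mulr_suml w1 mul1r.
  apply: eq_bigr => j _; case: eqP => [->|//]; by rewrite subrr !mulr0.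
have W1 : \sum_j (if j == i then 0 else w j) = 1 - w i.
  rewrite -w1 [in RHS](bigD1 i) //= (bigD1 i) //= eqxx add0r addrAC subrr add0r.
  by apply: eq_bigr => j /negbTE ->.
rewrite mE -W1; apply: le_trans (sqr_wsum_le _ _ _) _.
  by move=> j; case: eqP.
rewrite ler_wpM2l ?sumr_ge0 // => [j _|]; first by case: eqP.
apply: ler_sum => j _; case: eqP => // _.
by rewrite mul0r mulr_ge0 // sqr_ge0.
Qed.

Lemma wvariance_le_pairs {R : realFieldType} {I : finType} (w z : I -> R) (mu : R) :
  (forall i, 0 <= w i <= mu) -> \sum_i w i = 1 ->
  2 * \sum_i w i * (z i - \sum_j w j * z j) ^+ 2
    <= mu ^+ 2 * \sum_(ij : I * I) (z ij.1 - z ij.2) ^+ 2.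
Proof.
move=> wmu w1; set m := \sum_j w j * z j; set V := \sum_i _.
have -> : 2 * V = \sum_j w j * \sum_i w i * (z i - z j) ^+ 2.
  under eq_bigr => j _ do rewrite (wvariance_shift w z (z j) w1) -/m -/V mulrDr.
  rewrite big_split /= -mulr_suml w1 mul1r mulr_natl mulr2n; congr (_ + _).
  by apply: eq_bigr => j _; rewrite -[in RHS]sqrrN opprB.
rewrite -(pair_bigA _ (fun i j => (z i - z j) ^+ 2)) /= mulr_sumr.
apply: ler_sum => j _; rewrite !mulr_sumr; apply: ler_sum => i _.
have /andP[i0 i1] := wmu i; have /andP[j0 j1] := wmu j.
rewrite mulrA -[(z i - z j) ^+ 2]sqrrN opprB ler_wpM2r ?sqr_ge0 //.
by rewrite expr2 ler_pM.
Qed.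

(** * Shortest paths, coverings and the Poincare inequality *)

(** Cauchy-Schwarz for the telescoping sum of the increments along the path. *)
Lemma sqr_path_le {R : realFieldType} {T : eqType} (z : T -> R) (x : T) (p : seq T) :
  (z x - z (last x p)) ^+ 2
    <= (size p)%:R * \sum_(uv <- zip (x :: p) p) (z uv.1 - z uv.2) ^+ 2.
Proof.
elim: p x => [|y p IHp] x /=; first by rewrite subrr expr0n mul0r.
rewrite big_cons /=; have := IHp y; set s := \sum_(_ <- _) _.
have s0 : 0 <= s by apply: sumr_ge0 => uv _; apply: sqr_ge0.
set u := z y - _ => us; set v := z x - z y.
have -> : z x - z (last y p) = v + u by rewrite /u /v; ring.
have m0 : 0 <= (size p)%:R :> R by apply: ler0n.
rewrite -natr1; move: us m0; set m := (size p)%:R => us m0.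
have [m_eq0|mn0] := eqVneq m 0.
  move: us; rewrite m_eq0 mul0r => u2.
  have /eqP : u ^+ 2 = 0 by apply/eqP; rewrite eq_le u2 sqr_ge0.
  by rewrite sqrf_eq0 => /eqP ->; rewrite addr0; lra.
have mp : 0 < m by rewrite lt_neqAle eq_sym mn0.
suff : m * (2 * v * u) <= m * (m * v ^+ 2 + s) by rewrite ler_pM2l //; nra.
have := sqr_ge0 (m * v - u); nra.
Qed.

(** The path found by the search in [distance] is shortened to a simple one, and minimality of the
    search shows that no length is lost. Simplicity is needed later to count the edges of a path
    without multiplicity. *)
Lemma distanceP {T : finType} (e : rel T) (x y : T) : connect e x y ->
  exists2 p, [&& dipath e x y p, uniq (x :: p) & size p == distance e x y]
           & (size p < #|T|)%N.
Proof.
move=> /connectP[q eq yq].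
have short (r : seq T) : path e x r -> y = last x r ->
  exists s : seq T, [/\ dipath e x y s, uniq (x :: s) & (size s <= size r)%N].
  move=> pr lr; case: (shortenP pr) lr => s ps us sub lr; exists s; split=> //.
    by rewrite /dipath ps lr eqxx.
  by apply: uniq_leq_size => //; case/andP: us.
have small (s : seq T) : uniq (x :: s) -> (size s < #|T|)%N.
  by move=> us; have := max_card [in x :: s]; rewrite (card_uniqP us).
pose a m := [exists p : m.-tuple T, dipath e x y p].
have aP (s : seq T) : dipath e x y s -> a (size s).
  by move=> ds; apply/existsP; exists (in_tuple s).
have [s [ds us _]] := short q eq yq.
have hasa : has a (iota 0 #|T|).
  by apply/hasP; exists (size s); rewrite ?aP // mem_iota add0n small.
have dlt : (distance e x y < #|T|)%N.
  by move: hasa; rewrite has_find size_iota.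
have : a (distance e x y).
  by have := nth_find 0%N hasa; rewrite -/(distance e x y) nth_iota.
case/existsP => p dp; move: (dp) => /andP[pp /eqP lp].
have [r [dr ur sr]] := short p pp (esym lp).
exists r; last exact: small.
rewrite dr ur /= eqn_leq (leq_trans sr) ?size_tuple //=.
rewrite leqNgt; apply/negP => rlt.
have := before_find 0%N rlt.
by rewrite nth_iota ?small //= add0n -/(a (size r)) aP.
Qed.

Lemma exists_covering {T : finType} (e : rel T) : strongly_connected e ->
  exists2 P : covering T, is_covering e P
    & forall xy, xy.1 != xy.2 -> uniq (xy.1 :: P xy).
Proof.
move=> econ.
have ch (xy : T * T) : {p : #|T|.-bseq T |
    dipath e xy.1 xy.2 p && (size p == distance e xy.1 xy.2)
    & uniq (xy.1 :: p)}.
  apply: cid2; have [p /and3P[dp up sp] plt] := distanceP e _ _ (econ xy.1 xy.2).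
  by exists (Bseq (ltnW plt)) => //=; rewrite dp sp.
exists [ffun xy => s2val (ch xy)].
  apply/forallP => xy; apply/implyP => _; rewrite ffunE; exact: (s2valP (ch xy)).
by move=> xy _; rewrite ffunE; exact: (s2valP' (ch xy)).
Qed.

Lemma path_zip_edges {T : eqType} (e : rel T) (x : T) (p : seq T) :
  path e x p -> all (fun uv => e uv.1 uv.2) (zip (x :: p) p).
Proof. by elim: p x => //= y p IHp x /andP[-> /IHp]. Qed.

(* A Poincare inequality: route each pair of nodes along its path of a covering,
   and count how often each edge is used. *)
Lemma pairs_le_edges {R : realFieldType} {T : finType} (e : rel T) (z : T -> R) :
  strongly_connected e ->
  \sum_(xy : T * T) (z xy.1 - z xy.2) ^+ 2 <=
  (diameter e)%:R * (max_load e)%:R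
    * \sum_(uv : T * T | e uv.1 uv.2) (z uv.1 - z uv.2) ^+ 2.
Proof.
move=> econ; have [P Pcov Puniq] := exists_covering e econ.
have w0 (uv : T * T) : 0 <= (z uv.1 - z uv.2) ^+ 2 by apply: sqr_ge0.
have step (xy : T * T) : xy.1 != xy.2 -> (z xy.1 - z xy.2) ^+ 2 <=
    (diameter e)%:R * \sum_(uv : T * T | e uv.1 uv.2 && on_path xy.1 (P xy) uv)
      (z uv.1 - z uv.2) ^+ 2.
  move=> xy12; move/forallP/(_ xy): Pcov; rewrite xy12 /= => /andP[/andP[pP /eqP lP] /eqP sP].
  rewrite -{1}lP; apply: le_trans (sqr_path_le z _ _) _.
  apply: ler_pM; rewrite ?ler0n ?sumr_ge0 //.
    by rewrite ler_nat sP; exact: (leq_bigmax xy).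
  have uz : uniq (zip (xy.1 :: P xy) (P xy)).
    by apply: zip_uniqr; have /andP[] := Puniq xy xy12.
  rewrite big_uniq //= le_eqVlt; apply/orP; left; apply/eqP.
  apply: eq_bigl => uv; rewrite /on_path; apply/idP/andP => [uvP|[]//].
  by split=> //; have /allP := path_zip_edges e _ _ pP; apply.
rewrite (bigID (fun xy : T * T => xy.1 != xy.2)) /=.
rewrite [X in _ + X <= _]big1 ?addr0; last first.
  by move=> xy; rewrite negbK => /eqP ->; rewrite subrr expr0n.
apply: le_trans (ler_sum _ step) _.
rewrite -mulr_sumr -mulrA ler_wpM2l ?ler0n //.
rewrite (exchange_big_dep (fun uv : T * T => e uv.1 uv.2)) /=; last first.
  by move=> xy uv _ /andP[].
rewrite mulr_sumr; apply: ler_sum => uv euv.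
rewrite sumr_const -[X in X <= _]mulr_natl ler_wpM2r // ler_nat.
apply: leq_trans (leq_bigmax_cond _ Pcov).
apply: leq_trans (leq_bigmax_cond (P := fun uv => e uv.1 uv.2) _ euv).
rewrite leq_eqVlt; apply/orP; left; apply/eqP; apply: eq_card => xy.
(* The set in [covering_load] is a classical set, so membership in it is the [asbool] of the boolean
   condition. *)
rewrite [RHS](_ : _ =
  asbool (is_true ((xy.1 != xy.2) && on_path xy.1 (P xy) uv))) //.
by rewrite asboolb unfold_in /= euv.
Qed.

(** * Contraction of the variance by one averaging step *)

(** Law of total variance: as [w'] mixes the rows of [W] into [w], the variance lost by averaging is
    the [w']-mean of the variances inside the rows. Each of these dominates the squared differences
    along the edges into its node, and the Poincare inequality compares the sum over all edges with
    the variance itself. *)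
Lemma wvariance_contraction {R : realFieldType} {I : finType} (e : rel I)
    (w w' : I -> R) (W : I -> I -> R) (q mu c : R) (z : I -> R) :
  strongly_connected e ->
  (forall i, 0 <= w i <= mu) -> \sum_i w i = 1 -> (forall i, 0 <= w' i) ->
  (forall i j, 0 <= W i j) -> (forall i, \sum_j W i j = 1) ->
  (forall j, \sum_i w' i * W i j = w j) ->
  0 <= q -> (forall i j, e j i -> q <= w' i * (W i j * W i i)) ->
  c <= q / (mu ^+ 2 * (diameter e)%:R * (max_load e)%:R) ->
  \sum_i w' i * (\sum_j W i j * z j - \sum_j w j * z j) ^+ 2
    <= (1 - 2 * c) * \sum_j w j * (z j - \sum_j w j * z j) ^+ 2.
Proof.
move=> econ wmu w1 w'0 W0 W1 wE q0 qle; set D := mu ^+ 2 * _ * _ => cle.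
have V2 := wvariance_le_pairs w z mu wmu w1; move: V2.
set m := \sum_j w j * z j; set V := \sum_j w j * _ => V2.
have VE : V = \sum_i w' i * \sum_j W i j * (z j - m) ^+ 2.
  under [RHS]eq_bigr => i _ do rewrite mulr_sumr.
  rewrite exchange_big /=; apply: eq_bigr => j _.
  by under eq_bigr => i _ do rewrite mulrA; rewrite -mulr_suml wE.
have decr : q * \sum_(uv : I * I | e uv.1 uv.2) (z uv.1 - z uv.2) ^+ 2
    <= V - \sum_i w' i * (\sum_j W i j * z j - m) ^+ 2.
  rewrite VE -sumrB mulr_sumr.
  rewrite -(pair_big_dep xpredT e (fun u v => q * (z u - z v) ^+ 2)) /=.
  rewrite (exchange_big_dep xpredT) //=; apply: ler_sum => i _.
  rewrite (wvariance_shift (W i) z m (W1 i)) -mulrBr addrK.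
  apply: le_trans (_ : w' i * \sum_j W i j * W i i * (z j - z i) ^+ 2 <= _); last first.
    by rewrite ler_wpM2l // wvariance_ge_edges.
  rewrite mulr_sumr [X in _ <= X](bigID (fun j => e j i)) /= -[X in X <= _]addr0.
  apply: lerD; last by apply: sumr_ge0 => j _; rewrite mulr_ge0 // mulr_ge0 ?sqr_ge0 // mulr_ge0.
  by apply: ler_sum => j eji; rewrite mulrA ler_wpM2r ?sqr_ge0 // qle.
suff : 2 * c * V <= V - \sum_i w' i * (\sum_j W i j * z j - m) ^+ 2 by lra.
apply: le_trans decr.
have poin := pairs_le_edges e z econ.
have D0 : 0 <= D by rewrite /D mulr_ge0 ?ler0n // mulr_ge0 ?ler0n ?sqr_ge0.
set E := \sum_(uv : I * I | e uv.1 uv.2) _ in poin *.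
have E0 : 0 <= E by apply: sumr_ge0 => uv _; apply: sqr_ge0.
have V0 : 0 <= V.
  by apply: sumr_ge0 => i _; rewrite mulr_ge0 ?sqr_ge0 //; case/andP: (wmu i).
have V2D : 2 * V <= D * E.
  apply: (le_trans V2).
  have -> : D * E = mu ^+ 2 * ((diameter e)%:R * (max_load e)%:R * E) by rewrite /D; ring.
  by apply: ler_wpM2l poin; apply: sqr_ge0.
(* [c] is bounded only from above; when it is not positive the left side is not positive either. *)
have [c_le0|c_gt0] := leP c 0.
  by apply: le_trans (_ : 0 <= _); rewrite ?mulr_ge0 // mulr_le0_ge0 //; lra.
have cD : c * D <= q.
  have [->|Dn0] := eqVneq D 0; first by rewrite mulr0.
  by rewrite -ler_pdivlMr // lt_neqAle eq_sym Dn0.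
apply: le_trans (_ : c * (D * E) <= _); last by rewrite mulrA ler_wpM2r.
by rewrite [2 * c]mulrC -mulrA ler_wpM2l // ltW.
Qed.

(** * Euclidean norm, gradients and the descent lemma *)

Definition dot {R : realType} {d : nat} (u v : 'rV[R]_d) : R :=
  \sum_l u 0 l * v 0 l.

Lemma enorm_sqr {R : realType} {d : nat} (v : 'rV[R]_d) :
  enorm v ^+ 2 = \sum_l v 0 l ^+ 2.
Proof. by rewrite sqr_sqrtr // sumr_ge0 // => l _; apply: sqr_ge0. Qed.

Lemma dot_young {R : realType} {d : nat} (u v : 'rV[R]_d) (s : R) : 0 < s ->
  2 * dot u v <= s^-1 * enorm u ^+ 2 + s * enorm v ^+ 2.
Proof.
move=> s0; rewrite !enorm_sqr /dot !mulr_sumr -big_split /=.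
apply: ler_sum => l _; have := sqr_ge0 (u 0 l - s * v 0 l).
rewrite -(ler_pM2l s0 (2 * _)) mulrDr (mulrA s s^-1) mulfV ?gt_eqF // mul1r; nra.
Qed.

Lemma smooth_sqr {R : realType} {d : nat} (L : R) (f : 'rV[R]_d -> R) x y :
  smooth L f ->
  enorm (grad f x - grad f y) ^+ 2 <= L ^+ 2 * enorm (x - y) ^+ 2.
Proof.
move=> [_ /(_ x y) lip]; rewrite -exprMn; apply: lerXn2r (lip);
  rewrite nnegrE; first exact: sqrtr_ge0.
by apply: le_trans lip; exact: sqrtr_ge0.
Qed.

Lemma derive_dot_grad {R : realType} {d : nat} (f : 'rV[R]_d -> R) x h :
  differentiable f x -> 'D_h f x = dot (grad f x) h.
Proof.
move=> df; rewrite deriveE // {1}[h]row_sum_delta linear_sum /dot.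
by apply: eq_bigr => l _; rewrite linearZ /= mxE deriveE // mulrC.
Qed.

Lemma is_derive_line {R : realType} {d : nat} (f : 'rV[R]_d -> R) x h (t : R) :
  differentiable f (x + t *: h) ->
  is_derive t 1 (fun s : R => f (x + s *: h)) (dot (grad f (x + t *: h)) h).
Proof.
move=> df; have fE : (fun k : R => k^-1 *:
      (((fun s : R => f (x + s *: h)) \o shift t) (k *: 1) - f (x + t *: h))) =
    (fun k : R => k^-1 *: ((f \o shift (x + t *: h)) (k *: h) - f (x + t *: h))).
  apply/funext => k /=; congr (_ *: (f _ - _)).
  by rewrite [k *: 1]mulr1 scalerDl addrCA.
apply: DeriveDef; first by rewrite /derivable fE; exact: diff_derivable.
by rewrite /derive fE -/(derive f (x + t *: h) h) derive_dot_grad.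
Qed.

(** Along the segment, [phi] is [f] minus the linear and quadratic terms of the claim. Its
    derivative is nonpositive because the gradient is Lipschitz, so the mean value theorem does the
    work of the usual integral. *)
Lemma descent_lemma {R : realType} {d : nat} (L : R) (f : 'rV[R]_d -> R) x h :
  0 < L -> smooth L f ->
  f (x + h) <= f x + dot (grad f x) h + L / 2 * enorm h ^+ 2.
Proof.
move=> L0 sf; have [df _] := sf.
set c := dot (grad f x) h; set k := L / 2 * enorm h ^+ 2.
pose phi : R -> R := (fun s : R => f (x + s *: h)) - c \*: id - k \*: (id ^+ 2).
pose dphi (t : R) : R := dot (grad f (x + t *: h)) h - c - k * (2 * t).
have dphiE (t : R) : is_derive t 1 phi (dphi t).
  have := is_derive_line f x h t (df _) => ?.
  apply: is_derive_eq; rewrite /dphi /=.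
  by rewrite /GRing.scale /= expr1 !mulr1 mulrC.
have cont : {within `[0, 1], continuous phi}.
  apply: derivable_within_continuous => t _; exact: ex_derive.
have [t] := MVT ltr01 (fun t _ => dphiE t) cont.
rewrite in_itv /= => /andP[t0 t1]; rewrite subr0 mulr1.
have -> : phi 1 - phi 0 = f (x + h) - f x - c - k.
  rewrite /phi !fctE /= scale1r scale0r addr0 expr1n expr0n /=.
  by rewrite /GRing.scale /= !mulr1 !mulr0; ring.
suff : dphi t <= 0 by rewrite /phi => + e; rewrite -e; lra.
rewrite /dphi /c.
have -> : dot (grad f (x + t *: h)) h - dot (grad f x) h
    = dot (grad f (x + t *: h) - grad f x) h.
  by rewrite /dot -sumrB; apply: eq_bigr => l _; rewrite !mxE mulrBl.
(* The weight [L * t] in Young's inequality bounds both of its terms by [L * t * enorm h ^+ 2], so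
   nothing is lost. *)
have Lt : 0 < L * t by rewrite mulr_gt0.
have := dot_young (grad f (x + t *: h) - grad f x) h _ Lt.
have := smooth_sqr L f (x + t *: h) x sf.
have -> : x + t *: h - x = t *: h by rewrite addrAC subrr add0r.
have -> : enorm (t *: h) ^+ 2 = t ^+ 2 * enorm h ^+ 2.
  by rewrite !enorm_sqr mulr_sumr; apply: eq_bigr => l _; rewrite mxE exprMn.
set u := enorm _ ^+ 2; set v := enorm h ^+ 2; set D := dot _ _ => uv.
have : (L * t)^-1 * u <= L * t * v by rewrite mulrC ler_pdivrMr //; nra.
by rewrite /k -/v; nra.
Qed.

(** * Averages and variances of families of vectors, and averaging steps *)

Definition wavg {R : realType} {I : finType} {d : nat} (w : I -> R)
  (X : I -> 'rV[R]_d) : 'rV[R]_d := \sum_i w i *: X i.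

Definition wvar {R : realType} {I : finType} {d : nat} (w : I -> R)
  (X : I -> 'rV[R]_d) : R := \sum_i w i * enorm (X i - wavg w X) ^+ 2.

Lemma wavg_coord {R : realType} {I : finType} {d : nat} (w : I -> R)
    (X : I -> 'rV[R]_d) l :
  wavg w X 0 l = \sum_i w i * X i 0 l.
Proof. by rewrite summxE; apply: eq_bigr => i _; rewrite mxE. Qed.

Lemma wsum_enorm {R : realType} {I : finType} {d : nat} (w : I -> R)
    (X : I -> 'rV[R]_d) :
  \sum_i w i * enorm (X i) ^+ 2 = \sum_l \sum_i w i * X i 0 l ^+ 2.
Proof.
rewrite exchange_big /=; apply: eq_bigr => i _.
by rewrite enorm_sqr mulr_sumr.
Qed.

(** Squared Euclidean norms split over coordinates, which transfers the scalar variance estimates to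
    vectors with the same constants. *)
Lemma wvar_coord {R : realType} {I : finType} {d : nat} (w : I -> R)
    (X : I -> 'rV[R]_d) :
  wvar w X = \sum_l \sum_i w i * (X i 0 l - \sum_j w j * X j 0 l) ^+ 2.
Proof.
rewrite /wvar (wsum_enorm w (fun i => X i - wavg w X)).
apply: eq_bigr => l _; apply: eq_bigr => i _; congr (_ * _ ^+ 2).
by rewrite !mxE wavg_coord.
Qed.

Lemma enorm_wavg_le {R : realType} {I : finType} {d : nat} (w : I -> R)
    (X : I -> 'rV[R]_d) : (forall i, 0 <= w i) ->
  enorm (wavg w X) ^+ 2 <= (\sum_i w i) * \sum_i w i * enorm (X i) ^+ 2.
Proof.
move=> w0; rewrite enorm_sqr wsum_enorm mulr_sumr; apply: ler_sum => l _.
by rewrite wavg_coord sqr_wsum_le.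
Qed.

Lemma enorm_sum_le {R : realType} {I : finType} {d : nat} (X : I -> 'rV[R]_d) :
  enorm (\sum_i X i) ^+ 2 <= #|I|%:R * \sum_i enorm (X i) ^+ 2.
Proof.
have := enorm_wavg_le (fun=> 1) X (fun=> ler01).
rewrite sumr_const /wavg; under eq_bigr do rewrite scale1r.
by under [X in _ <= _ * X]eq_bigr do rewrite mul1r.
Qed.

Lemma wvar_ge0 {R : realType} {I : finType} {d : nat} (w : I -> R)
    (X : I -> 'rV[R]_d) : (forall i, 0 <= w i) -> 0 <= wvar w X.
Proof. by move=> w0; apply: sumr_ge0 => i _; rewrite mulr_ge0 ?sqr_ge0. Qed.

Lemma wvar_shift {R : realType} {I : finType} {d : nat} (w : I -> R)
    (X : I -> 'rV[R]_d) (v : 'rV[R]_d) : \sum_i w i = 1 ->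
  \sum_i w i * enorm (X i - v) ^+ 2 = wvar w X + enorm (wavg w X - v) ^+ 2.
Proof.
move=> w1; rewrite (wsum_enorm w (fun i => X i - v)) wvar_coord enorm_sqr -big_split /=.
apply: eq_bigr => l _; rewrite !mxE wavg_coord -wvariance_shift //.
by apply: eq_bigr => i _; rewrite !mxE.
Qed.

Lemma wvar_second_moment {R : realType} {I : finType} {d : nat} (w : I -> R)
    (X : I -> 'rV[R]_d) : \sum_i w i = 1 ->
  \sum_i w i * enorm (X i) ^+ 2 = wvar w X + enorm (wavg w X) ^+ 2.
Proof.
by move=> w1; have := wvar_shift w X 0 w1; rewrite subr0;
  under eq_bigr do rewrite subr0.
Qed.

Lemma enormD3_le {R : realType} {d : nat} (u v w : 'rV[R]_d) :
  enorm (u + v + w) ^+ 2 <= 3 * (enorm u ^+ 2 + enorm v ^+ 2 + enorm w ^+ 2).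
Proof.
rewrite !enorm_sqr -!big_split mulr_sumr; apply: ler_sum => l _ /=; rewrite !mxE.
have := sqr_ge0 (u 0 l - v 0 l); have := sqr_ge0 (u 0 l - w 0 l).
by have := sqr_ge0 (v 0 l - w 0 l); nra.
Qed.

Lemma enormD_le {R : realType} {d : nat} (u v : 'rV[R]_d) :
  enorm (u + v) ^+ 2 <= 2 * (enorm u ^+ 2 + enorm v ^+ 2).
Proof.
rewrite !enorm_sqr -!big_split mulr_sumr; apply: ler_sum => l _ /=; rewrite !mxE.
by have := sqr_ge0 (u 0 l - v 0 l); nra.
Qed.

Lemma enormZ_sqr {R : realType} {d : nat} (a : R) (v : 'rV[R]_d) :
  enorm (a *: v) ^+ 2 = a ^+ 2 * enorm v ^+ 2.
Proof.
by rewrite !enorm_sqr mulr_sumr; apply: eq_bigr => l _; rewrite mxE exprMn.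
Qed.

Lemma enormN_sqr {R : realType} {d : nat} (v : 'rV[R]_d) :
  enorm (- v) ^+ 2 = enorm v ^+ 2.
Proof. by rewrite -scaleN1r enormZ_sqr sqrrN expr1n mul1r. Qed.

(* A step W with w'^T W = w^T shrinks the w-variance by the factor 1 - 2 c; the
   spare factor 2 is spent in averaging_perturbed. *)
Record averaging {R : realType} {I : finType} (e : rel I) (w w' : I -> R)
    (W : I -> I -> R) (c : R) : Prop := Averaging {
  avg_connected : strongly_connected e;
  avg_w_gt0 : forall i, 0 < w i;
  avg_w_sum : \sum_i w i = 1;
  avg_w'_ge0 : forall i, 0 <= w' i;
  avg_W_ge0 : forall i j, 0 <= W i j;
  avg_W_sum : forall i, \sum_j W i j = 1;
  avg_W_step : forall j, \sum_i w' i * W i j = w j;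
  avg_rate : exists q mu, [/\ 0 <= q, forall i, w i <= mu,
    forall i j, e j i -> q <= w' i * (W i j * W i i)
    & c <= q / (mu ^+ 2 * (diameter e)%:R * (max_load e)%:R)] }.

Lemma averaging_contraction {R : realType} {I : finType} (e : rel I)
    (w w' : I -> R) (W : I -> I -> R) (c : R) (z : I -> R) :
  averaging e w w' W c ->
  \sum_i w' i * (\sum_j W i j * z j - \sum_j w j * z j) ^+ 2
    <= (1 - 2 * c) * \sum_j w j * (z j - \sum_j w j * z j) ^+ 2.
Proof.
case=> econ w0 w1 w'0 W0 W1 wE [q [mu [q0 wmu qle cle]]].
by apply: (wvariance_contraction e w w' W q mu c) => // i; rewrite wmu ltW.
Qed.

(* A non-constant vector has positive variance, which a contraction cannot turn
   negative. *)
Lemma averaging_rate_le {R : realType} {I : finType} (e : rel I)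
    (w w' : I -> R) (W : I -> I -> R) (c : R) :
  averaging e w w' W c -> (1 < #|I|)%N -> c <= 1 / 2.
Proof.
move=> avg /card_gt1P[i [j [_ _ ij]]]; pose z (k : I) : R := (k == i)%:R.
have := averaging_contraction e w w' W c z avg.
set m := \sum_j w j * z j; set V := \sum_j w j * _ ^+ 2 => contr.
have lhs0 : 0 <= \sum_i w' i * (\sum_j W i j * z j - m) ^+ 2.
  by apply: sumr_ge0 => k _; rewrite mulr_ge0 ?sqr_ge0 ?(avg_w'_ge0 _ _ _ _ _ avg).
have w0 := avg_w_gt0 _ _ _ _ _ avg.
have V0 : 0 < V.
  rewrite /V (bigD1 i) // (bigD1 j) 1?eq_sym //= {1 2}/z eqxx eq_sym (negbTE ij) addrA.
  apply: ltr_wpDr.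
    by apply: sumr_ge0 => k _; rewrite mulr_ge0 ?sqr_ge0 ?ltW.
  (* [z] is the indicator of [i]: the term of [j] is positive if the mean is 1, and the term of [i]
     is positive otherwise. *)
  have [->|m1] := eqVneq m 1.
    by rewrite subrr expr0n mulr0 add0r sub0r sqrrN expr1n mulr1.
  apply: ltr_wpDr; first by rewrite mulr_ge0 ?sqr_ge0 ?(ltW (w0 _)).
  by rewrite pmulr_rgt0 // exprn_even_gt0 //= subr_eq0 eq_sym.
have : 0 <= (1 - 2 * c) * V by apply: le_trans contr.
by rewrite pmulr_lge0 //; lra.
Qed.

Lemma averaging_w'_sum {R : realType} {I : finType} (e : rel I)
    (w w' : I -> R) (W : I -> I -> R) (c : R) :
  averaging e w w' W c -> \sum_i w' i = 1.
Proof.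
move=> avg; rewrite -(avg_w_sum _ _ _ _ _ avg).
under [RHS]eq_bigr => j _ do rewrite -(avg_W_step _ _ _ _ _ avg).
rewrite exchange_big /=; apply: eq_bigr => i _.
by rewrite -mulr_sumr (avg_W_sum _ _ _ _ _ avg) mulr1.
Qed.

Lemma averaging_mean {R : realType} {I : finType} (e : rel I)
    (w w' : I -> R) (W : I -> I -> R) (c : R) (z : I -> R) :
  averaging e w w' W c ->
  \sum_i w' i * (\sum_j W i j * z j) = \sum_j w j * z j.
Proof.
move=> avg; under eq_bigr do rewrite mulr_sumr.
rewrite exchange_big /=; apply: eq_bigr => j _.
by under eq_bigr do rewrite mulrA; rewrite -mulr_suml (avg_W_step _ _ _ _ _ avg).
Qed.

Lemma averaging_wavg {R : realType} {I : finType} {d : nat} (e : rel I)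
    (w w' : I -> R) (W : I -> I -> R) (c : R) (X : I -> 'rV[R]_d) :
  averaging e w w' W c ->
  wavg w' (fun i => \sum_j W i j *: X j) = wavg w X.
Proof.
move=> avg; apply/rowP => l; rewrite !wavg_coord.
rewrite -(averaging_mean e w w' W c (fun j => X j 0 l) avg).
apply: eq_bigr => i _; rewrite summxE; congr (_ * _).
by apply: eq_bigr => j _; rewrite mxE.
Qed.

(** Young's inequality in the form [(u + v) ^+ 2 <= u ^+ 2 / (1 - c) + v ^+ 2 / c], followed by
    [(1 - 2 * c) / (1 - c) <= 1 - c]. The mean moves by the mean of [y], so the perturbation enters
    through its variance, which its second moment bounds. *)
Lemma averaging_perturbed {R : realType} {I : finType} (e : rel I)
    (w w' : I -> R) (W : I -> I -> R) (c : R) (z z' y : I -> R) :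
  averaging e w w' W c -> 0 < c -> (1 < #|I|)%N ->
  (forall i, z' i = \sum_j W i j * z j + y i) ->
  \sum_i w' i * (z' i - \sum_j w' j * z' j) ^+ 2 <=
  (1 - c) * \sum_j w j * (z j - \sum_j w j * z j) ^+ 2
  + c^-1 * \sum_i w' i * y i ^+ 2.
Proof.
move=> avg c0 cI z'E; have c12 := averaging_rate_le e w w' W c avg cI.
have contr := averaging_contraction e w w' W c z avg; move: contr.
have -> : \sum_j w' j * z' j = \sum_j w j * z j + \sum_j w' j * y j.
  rewrite -(averaging_mean e w w' W c z avg) -big_split /=.
  by apply: eq_bigr => j _; rewrite z'E mulrDr.
set m := \sum_j w j * z j; set my := \sum_j w' j * y j.
set V := \sum_j w j * _ ^+ 2 => contr.
have w'0 := avg_w'_ge0 _ _ _ _ _ avg.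
have V0 : 0 <= V.
  by apply: sumr_ge0 => j _; rewrite mulr_ge0 ?sqr_ge0 // ltW // (avg_w_gt0 _ _ _ _ _ avg).
have yvar : \sum_i w' i * (y i - my) ^+ 2 <= \sum_i w' i * y i ^+ 2.
  have := wvariance_shift w' y 0 (averaging_w'_sum e w w' W c avg).
  under eq_bigr do rewrite subr0.
  by move=> ->; rewrite lerDl sqr_ge0.
have c1 : 0 < 1 - c by lra.
apply: le_trans (_ : (1 - c)^-1 * ((1 - 2 * c) * V) +
                     c^-1 * (\sum_i w' i * (y i - my) ^+ 2) <= _); last first.
  apply: lerD; last by rewrite ler_wpM2l // invr_ge0 ltW.
  by rewrite mulrC ler_pdivrMr // mulrAC ler_wpM2r //; nra.
apply: le_trans (_ : (1 - c)^-1 * (\sum_i w' i * (\sum_j W i j * z j - m) ^+ 2) +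
                     c^-1 * (\sum_i w' i * (y i - my) ^+ 2) <= _); last first.
  by rewrite lerD2r ler_wpM2l // invr_ge0 ltW.
rewrite [(1 - c)^-1 * _]mulr_sumr [c^-1 * _]mulr_sumr -[X in _ <= X]big_split /=.
apply: ler_sum => i _; rewrite (mulrCA _ (w' i)) (mulrCA _ (w' i)) -mulrDr ler_wpM2l //.
rewrite z'E; set u := \sum_j _ - m; set v := y i - my.
have -> : \sum_j W i j * z j + y i - (m + my) = u + v by rewrite /u /v; ring.
rewrite -subr_ge0.
have -> : (1 - c)^-1 * u ^+ 2 + c^-1 * v ^+ 2 - (u + v) ^+ 2
    = (c * u - (1 - c) * v) ^+ 2 / (c * (1 - c)).
  by field; rewrite !gt_eqF.
by rewrite divr_ge0 ?sqr_ge0 // mulr_ge0 // ltW.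
Qed.

Lemma averaging_wvar {R : realType} {I : finType} {d : nat} (e : rel I)
    (w w' : I -> R) (W : I -> I -> R) (c : R) (X Y : I -> 'rV[R]_d) :
  averaging e w w' W c -> 0 < c -> (1 < #|I|)%N ->
  wvar w' (fun i => \sum_j W i j *: X j + Y i) <=
  (1 - c) * wvar w X + c^-1 * \sum_i w' i * enorm (Y i) ^+ 2.
Proof.
move=> avg c0 cI; rewrite !wvar_coord wsum_enorm !mulr_sumr -big_split /=.
apply: ler_sum => l _.
apply: (averaging_perturbed e w w' W) avg c0 cI _ => i.
by rewrite mxE summxE; congr (_ + _); apply: eq_bigr => j _; rewrite mxE.
Qed.

(** * Coefficients of the Lyapunov function *)

Ltac nonneg :=
  lazymatch goal with
  | |- is_true (0 <= _ ^+ 2) => exact: sqr_ge0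
  | |- is_true (0 <= _ ^+ _) => apply: exprn_ge0; nonneg
  | |- is_true (0 <= _ / _) => apply: divr_ge0; nonneg
  | |- is_true (0 <= _ * _) => apply: mulr_ge0; nonneg
  | |- is_true (0 <= _ %:R) => exact: ler0n
  | |- _ => first [assumption | apply: ltW; assumption | exact: ler01]
  end.

(** Certificate for comparing fractions: a known inequality and a nonnegative factor reduce the new
    one to a field identity. *)
Lemma le_slack {R : realFieldType} (f r s x y : R) :
  0 <= f -> r <= s -> y - x = f * (s - r) -> x <= y.
Proof. by move=> f0 rs xy; rewrite -subr_ge0 xy mulr_ge0 ?subr_ge0. Qed.

(** The three estimates are coupled: [V] and [S] enter [F'], while [S] and [T] feed back into [V']
    and [S']. The weight of [S] makes its contraction gain [4 * aup * H / N ^+ 2], enough for its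
    cost in [F'] and its feedbacks. Here [G] stands for the squared gradient norm of the objective,
    [T] for that of the sum of the trackers, and [al] for [a ^+ n]. *)
Lemma lyapunov_decrease {R : realFieldType}
    (N al aup L c e g H eta p F F' V V' S S' G T : R) :
  1 <= N -> 0 < al -> 0 < aup -> 0 < c <= 1 -> 0 < e <= 1 ->
  0 <= eta <= H -> al <= p * N <= aup -> 0 <= p <= 1 -> 0 <= g ->
  0 <= V -> 0 <= S -> 0 <= G ->
  12 * eta <= e * al ->
  768 * N ^+ 2 * (aup * (H * g * L ^+ 2)) <= c ^+ 2 * e ->
  32 * N ^+ 3 * (eta ^+ 2 * L ^+ 2) <= al * c ^+ 2 ->
  16 * N ^+ 2 * (aup * eta * L ^+ 2) <= c ^+ 2 ->
  F' <= F - eta * p * N / 2 * G + eta * p * L ^+ 2 * (N / al) * V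
        + eta * aup / N ^+ 2 * S ->
  V' <= (1 - c) * V + eta ^+ 2 * p / c * (S + T) ->
  S' <= (1 - e) * S
        + 3 * g * L ^+ 2 / e * (2 * (N / al) * V + eta ^+ 2 * (S + T)) ->
  T <= 2 * N ^+ 2 * G + 2 * L ^+ 2 * N * (N / al) * V ->
  F' + c / (2 * al * N * e) * V' + 4 * aup * H / (N ^+ 2 * e) * S'
  <= F + c / (2 * al * N * e) * V + 4 * aup * H / (N ^+ 2 * e) * S
     - eta * p * N / 4 * G - c ^+ 2 / (4 * al * N * e) * V.
Proof.
move=> N1 al0 aup0 /andP[c0 c1] /andP[e0 e1] /andP[eta0 etaH] /andP[alp paup].
move=> /andP[p0 p1] g0 V0 S0 G0.
have N0 : 0 < N by lra.
have H0 : 0 <= H by lra.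
have c2 : c ^+ 2 <= 1 by nra.
have N2 : 1 <= N ^+ 2 by nra.
have N3 : 1 <= N ^+ 3 by rewrite exprS; nra.
have al_N : al <= N by nra.
have p_aup : p * N / 16 <= aup by lra.
have eta2H : eta <= 2 * H by lra.
have N3_32 : 1 <= 32 * N ^+ 3 by lra.
have num1 : 1 / 24 + 1 / 768 <= 1 / 16 :> R by lra.
have num2 : 1 / 8 <= 1 / 4 :> R by lra.
have nN : N != 0 by rewrite gt_eqF.
have nal : al != 0 by rewrite gt_eqF.
have nc : c != 0 by rewrite gt_eqF.
have ne : e != 0 by rewrite gt_eqF.
move=> hB hA hC hD hF hV hS hT.
set Z := H * g * L ^+ 2 in hA.
(* [k1] and [k2] are the weighted coefficients with which [S + T] returns through [V'] and [S']; the
   contraction of [V] gains [u / 2]. *)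
pose k1 := eta ^+ 2 * p / (2 * al * N * e).
pose k2 := 12 * aup * Z * eta ^+ 2 / (N ^+ 2 * e ^+ 2).
pose u := c ^+ 2 / (al * N * e).
have Z0 : 0 <= Z by rewrite /Z; nonneg.
have k10 : 0 <= k1 by rewrite /k1; nonneg.
have k20 : 0 <= k2 by rewrite /k2; nonneg.
have u0 : 0 <= u by rewrite /u; nonneg.
have k1le : k1 <= eta * p / (24 * N).
  apply: (le_slack (eta * p / (24 * N * al * e)) (12 * eta) (e * al)) => //.
    by nonneg.
  by rewrite /k1; field; rewrite nN nal ne.
have k2le1 : k2 <= eta ^+ 2 * c ^+ 2 / (64 * N ^+ 4 * e).
  apply: (le_slack (eta ^+ 2 / (64 * N ^+ 4 * e ^+ 2)) _ _ _ _ _ hA).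
    by nonneg.
  by rewrite /k2; field; rewrite nN ne.
have k2le2 : eta ^+ 2 * c ^+ 2 / (64 * N ^+ 4 * e)
    <= eta * c ^+ 2 * al / (768 * N ^+ 4).
  apply: (le_slack (eta * c ^+ 2 / (768 * N ^+ 4 * e)) _ _ _ _ _ hB).
    by nonneg.
  by field; rewrite nN ne.
have k2le : k2 <= eta * p / (768 * N).
  apply: le_trans k2le1 _; apply: le_trans k2le2 _.
  apply: le_trans (_ : eta * al / (768 * N ^+ 4) <= _).
    apply: (le_slack (eta * al / (768 * N ^+ 4)) _ _ _ _ _ c2); first by nonneg.
    by field.
  apply: le_trans (_ : eta * p / (768 * N ^+ 3) <= _).
    apply: (le_slack (eta / (768 * N ^+ 4)) _ _ _ _ _ alp); first by nonneg.
    by field.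
  apply: (le_slack (eta * p / (768 * N ^+ 3)) _ _ _ _ _ N2); first by nonneg.
  by field.
have kle : k1 + k2 <= eta * p / (16 * N).
  apply: le_trans (lerD k1le k2le) _.
  apply: (le_slack (eta * p / N) _ _ _ _ _ num1); first by nonneg.
  by field.
have coefG : 2 * N ^+ 2 * (k1 + k2) <= eta * p * N / 4.
  apply: le_trans (ler_wpM2l _ kle) _; first by nonneg.
  apply: (le_slack (eta * p * N) _ _ _ _ _ num2); first by nonneg.
  by field.
have coefV1 : 2 * L ^+ 2 * N * (N / al) * k1 <= u / 32.
  apply: le_trans (_ : L ^+ 2 * N * eta ^+ 2 / (al ^+ 2 * e) <= _).
    apply: (le_slack (L ^+ 2 * N * eta ^+ 2 / (al ^+ 2 * e)) _ _ _ _ _ p1).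
      by nonneg.
    by rewrite /k1; field; rewrite nN nal ne.
  apply: le_trans (_ : u / (32 * N) <= _).
    apply: (le_slack (1 / (32 * N ^+ 2 * al ^+ 2 * e)) _ _ _ _ _ hC).
      by nonneg.
    by rewrite /u; field; rewrite nN nal ne.
  apply: (le_slack (u / (32 * N)) _ _ _ _ _ N1); first by nonneg.
  by field.
have coefV2 : 2 * L ^+ 2 * N * (N / al) * k2 <= u / 32.
  apply: le_trans (_ : 2 * L ^+ 2 * N * (N / al) *
                       (eta ^+ 2 * c ^+ 2 / (64 * N ^+ 4 * e)) <= _).
    by apply: ler_wpM2l => //; nonneg.
  apply: le_trans (_ : c ^+ 4 / (1024 * N ^+ 5 * e) <= _).
    apply: (le_slack (c ^+ 2 / (1024 * N ^+ 5 * al * e)) _ _ _ _ _ hC).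
      by nonneg.
    by field; rewrite nN nal ne.
  apply: le_trans (_ : c ^+ 2 / (1024 * N ^+ 5 * e) <= _).
    apply: (le_slack (c ^+ 2 / (1024 * N ^+ 5 * e)) _ _ _ _ _ c2).
      by nonneg.
    by field; rewrite nN ne.
  apply: le_trans (_ : c ^+ 2 / (1024 * N ^+ 4 * al * e) <= _).
    apply: (le_slack (c ^+ 2 / (1024 * N ^+ 5 * al * e)) _ _ _ _ _ al_N).
      by nonneg.
    by field; rewrite nN nal ne.
  apply: (le_slack (u / (1024 * N ^+ 3)) _ _ _ _ _ N3_32); first by nonneg.
  by rewrite /u; field; rewrite nN nal ne.
have coefV3 : eta * p * L ^+ 2 * (N / al) <= u / 16.
  apply: le_trans (_ : aup * eta * L ^+ 2 / al <= _).
    apply: (le_slack (eta * L ^+ 2 / al) _ _ _ _ _ paup); first by nonneg.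
    by field.
  apply: le_trans (_ : c ^+ 2 / (16 * N ^+ 2 * al) <= _).
    apply: (le_slack (1 / (16 * N ^+ 2 * al)) _ _ _ _ _ hD); first by nonneg.
    by field; rewrite nN nal.
  apply: (le_slack (c ^+ 2 / (16 * N ^+ 2 * al * e)) e N); first by nonneg.
    exact: le_trans e1 N1.
  by rewrite /u; field; rewrite nN nal ne.
have coefV4 : 24 * aup * Z / (N * e ^+ 2 * al) <= u / 32.
  apply: le_trans (_ : u / (32 * N ^+ 2) <= _).
    apply: (le_slack (1 / (32 * N ^+ 3 * e ^+ 2 * al)) _ _ _ _ _ hA).
      by nonneg.
    by rewrite /u; field; rewrite nN nal ne.
  apply: (le_slack (u / (32 * N ^+ 2)) _ _ _ _ _ N2); first by nonneg.
  by field.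
have coefS : eta * aup / N ^+ 2 + (k1 + k2) <= 4 * aup * H / N ^+ 2.
  apply: le_trans (_ : 2 * aup * eta / N ^+ 2 <= _); last first.
    apply: (le_slack (2 * aup / N ^+ 2) _ _ _ _ _ eta2H); first by nonneg.
    by field.
  have : eta * p / (16 * N) <= aup * eta / N ^+ 2.
    apply: (le_slack (eta / N ^+ 2) _ _ _ _ _ p_aup); first by nonneg.
    by field.
  have -> : 2 * aup * eta / N ^+ 2 = eta * aup / N ^+ 2 + aup * eta / N ^+ 2.
    by field.
  by move=> le; rewrite lerD2l; apply: le_trans kle le.
have hV' : c / (2 * al * N * e) * V'
    <= c / (2 * al * N * e) * V - u / 2 * V + k1 * (S + T).
  have := ler_wpM2l (_ : 0 <= c / (2 * al * N * e)) hV => /(_ _).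
  have -> : c / (2 * al * N * e) * ((1 - c) * V + eta ^+ 2 * p / c * (S + T))
    = c / (2 * al * N * e) * V - u / 2 * V + k1 * (S + T).
    by rewrite /u /k1; field; rewrite nN nal ne nc.
  by apply; nonneg.
have hS' : 4 * aup * H / (N ^+ 2 * e) * S'
    <= 4 * aup * H / (N ^+ 2 * e) * S - 4 * aup * H / N ^+ 2 * S
       + 24 * aup * Z / (N * e ^+ 2 * al) * V + k2 * (S + T).
  have := ler_wpM2l (_ : 0 <= 4 * aup * H / (N ^+ 2 * e)) hS => /(_ _).
  have -> : 4 * aup * H / (N ^+ 2 * e) * ((1 - e) * S
        + 3 * g * L ^+ 2 / e * (2 * (N / al) * V + eta ^+ 2 * (S + T)))
    = 4 * aup * H / (N ^+ 2 * e) * S - 4 * aup * H / N ^+ 2 * S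
       + 24 * aup * Z / (N * e ^+ 2 * al) * V + k2 * (S + T).
    by rewrite /k2 /Z; field; rewrite nN nal ne.
  by apply; nonneg.
have -> : c ^+ 2 / (4 * al * N * e) * V = u / 4 * V.
  by rewrite /u; field; rewrite nN nal ne.
(* Budget: the four feedbacks on [V] cost at most [5 * u / 32] of the gain [u / 2], and [u / 4] is
   kept. The feedback on [G] costs at most half of the descent term. *)
have hT' := ler_wpM2l (addr_ge0 k10 k20) hT.
have cG := ler_wpM2r G0 coefG.
have cV1 := ler_wpM2r V0 coefV1.
have cV2 := ler_wpM2r V0 coefV2.
have cV3 := ler_wpM2r V0 coefV3.
have cV4 := ler_wpM2r V0 coefV4.
have cS := ler_wpM2r S0 coefS.
have uV : 0 <= u * V by apply: mulr_ge0.
move: hT' cG cV1 cV2 cV3 cV4 cS hV' hS' hF.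
clear -uV.
lra.
Qed.

(** * Minima of lists, and the rate from a bounded sum *)

Lemma seq_min_le {R : realType} (s : seq R) (y : R) : y \in s -> seq_min s <= y.
Proof. by move=> ys; exact: (ge_bigmin_seq _ y xpredT id). Qed.

Lemma seq_max_ge {R : realType} (s : seq R) (y : R) : y \in s -> y <= seq_max s.
Proof. by move=> ys; exact: (le_bigmax_seq _ y xpredT id). Qed.

Lemma seq_min_ge {R : realType} (s : seq R) (m : R) :
  (0 < size s)%N -> (forall y, y \in s -> m <= y) -> m <= seq_min s.
Proof.
move=> s0 ms; rewrite /seq_min big_seq; apply: le_bigmin => //.
by apply: ms; case: s s0 => //= x s _; rewrite mem_head.
Qed.

Lemma vmin_le {R : realType} {n : nat} (v : 'cV[R]_n) i : vmin v <= v i 0.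
Proof. by apply: seq_min_le; apply/mapP; exists i; rewrite ?mem_enum. Qed.

Lemma vmax_ge {R : realType} {n : nat} (v : 'cV[R]_n) i : v i 0 <= vmax v.
Proof. by apply: seq_max_ge; apply/mapP; exists i; rewrite ?mem_enum. Qed.

Lemma vmin_ge {R : realType} {n : nat} (v : 'cV[R]_n) (m : R) : (0 < n)%N ->
  (forall i, m <= v i 0) -> m <= vmin v.
Proof.
move=> n0 mv; apply: seq_min_ge; first by rewrite size_map size_enum_ord.
by move=> _ /mapP[i _ ->].
Qed.

Lemma seq_min_iota_le {R : realType} (u : nat -> R) (m : nat) :
  m%:R * seq_min [seq u k | k <- iota 0 m] <= \sum_(k < m) u k.
Proof.
rewrite -[m in m%:R]card_ord mulr_natl -sumr_const; apply: ler_sum => k _.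
by apply: seq_min_le; apply/mapP; exists (val k); rewrite // mem_iota /= ltn_ord.
Qed.

(** The minimum runs over [K - 1] terms, and [1 / (K - 1) <= 2 / K] for [K >= 2]; hence the factor
    2. *)
Lemma seq_min_rate {R : realType} (u : nat -> R) (C : R) (K : nat) :
  (2 <= K)%N -> 0 <= C -> \sum_(k < K.-1) u k <= C ->
  seq_min [seq u k | k <- iota 0 K.-1] <= 2 * C * K%:R^-1.
Proof.
case: K => [//|[//|K]] _ C0 uC /=; have := le_trans (seq_min_iota_le u K.+1) uC.
set s := seq_min _; rewrite ler_pdivlMr ?ltr0n // -[K.+2%:R]natr1.
have K0 : 1 <= K.+1%:R :> R by rewrite ler1n.
set k := K.+1%:R in K0 *; have [s0|s0] := leP s 0; nra.
Qed.

(** * Smoothness of the objective *)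

Lemma differentiable_objective {R : realType} {n d : nat}
    (f : 'I_n -> 'rV[R]_d -> R) x :
  (forall i, differentiable (f i) x) -> differentiable (objective f) x.
Proof.
move=> df; have -> : objective f = n%:R^-1 \*: (\sum_(i < n) f i).
  by apply/funext => y; rewrite /objective /= fct_sumE.
by apply: differentiableZ; apply: differentiable_sum.
Qed.

Lemma grad_objective {R : realType} {n d : nat}
    (f : 'I_n -> 'rV[R]_d -> R) x :
  (forall i, differentiable (f i) x) ->
  grad (objective f) x = n%:R^-1 *: \sum_(i < n) grad (f i) x.
Proof.
move=> df; have -> : objective f = n%:R^-1 \*: (\sum_(i < n) f i).
  by apply/funext => y; rewrite /objective /= fct_sumE.
have der i v : derivable (f i) x v by exact: diff_derivable.
apply/rowP => l; rewrite !mxE summxE deriveZ; last exact: derivable_sum.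
rewrite derive_sum //.
by congr (_ * _); apply: eq_bigr => i _; rewrite mxE.
Qed.

Lemma sum_grad_lipschitz {R : realType} {n d : nat} (L : R)
    (f : 'I_n -> 'rV[R]_d -> R) (x y : 'I_n -> 'rV[R]_d) :
  (forall i, smooth L (f i)) ->
  enorm (\sum_i grad (f i) (x i) - \sum_i grad (f i) (y i)) ^+ 2
    <= n%:R * L ^+ 2 * \sum_i enorm (x i - y i) ^+ 2.
Proof.
move=> sf; rewrite -sumrB; apply: le_trans (enorm_sum_le _) _.
rewrite card_ord -mulrA ler_wpM2l ?ler0n // mulr_sumr.
by apply: ler_sum => i _; apply: smooth_sqr.
Qed.

Lemma smooth_objective {R : realType} {n d : nat} (L : R)
    (f : 'I_n -> 'rV[R]_d -> R) : (0 < n)%N -> 0 < L ->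
  (forall i, smooth L (f i)) -> smooth L (objective f).
Proof.
move=> n0 L0 sf; have df x i : differentiable (f i) x by case: (sf i).
split=> [x|x y]; first exact: differentiable_objective.
have nR : 0 < n%:R :> R by rewrite ltr0n.
rewrite -(@ler_pXn2r _ 2) ?nnegrE ?mulr_ge0 ?sqrtr_ge0 ?(ltW L0) // exprMn.
rewrite !grad_objective // -scalerBr enormZ_sqr.
have := sum_grad_lipschitz L f (fun=> x) (fun=> y) sf.
rewrite sumr_const card_ord -[_ *+ n]mulr_natl; set D := enorm (_ - _) ^+ 2 => hD.
apply: le_trans (ler_wpM2l _ hD) _; first by rewrite sqr_ge0.
by rewrite le_eqVlt; apply/orP; left; apply/eqP; field; rewrite gt_eqF.
Qed.

Lemma bounded_below_objective {R : realType} {n d : nat}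
    (f : 'I_n -> 'rV[R]_d -> R) :
  (forall i, bounded_below (f i)) -> bounded_below (objective f).
Proof.
move=> /choice[m mf]; exists (n%:R^-1 * \sum_i m i) => x.
by rewrite ler_wpM2l ?invr_ge0 ?ler0n //; apply: ler_sum.
Qed.

(** * The two mixings as averaging steps *)

Lemma averaging_alpha {R : realType} {n : nat} (G : nat -> rel 'I_n)
    (A : nat -> 'M[R]_n) (a : R) (alpha : nat -> 'cV[R]_n) (k : nat) :
  (0 < n)%N -> 0 < a -> (forall k, strongly_connected (G k)) ->
  (forall k, row_compatible (G k) a (A k)) ->
  (forall k, stochastic_vector (alpha k)) ->
  (forall k, (alpha k.+1)^T *m A k = (alpha k)^T) ->
  (forall k i, 0 < alpha k i 0) ->
  averaging (G k) (fun i => alpha k i 0) (fun i => alpha k.+1 i 0) (A k)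
    (c_inf G a alpha).
Proof.
move=> n0 a0 Gc Ac alphas astep alpha0; have [[A0 A1] Apos Age] := Ac k.
have vmin0 j : 0 <= vmin (alpha j) by apply: vmin_ge => // i; exact: ltW.
split=> //.
- by case: (alphas k).
- by move=> i; exact: ltW.
- move=> j; have := congr1 (fun M : 'rV[R]_n => M 0 j) (astep k); rewrite !mxE => <-.
  by apply: eq_bigr => i _; rewrite mxE.
(* These witnesses produce the quotient in [ck]: on an edge, the entry of [A k] and the diagonal
   entry of its row are both at least [a]. *)
exists (vmin (alpha k.+1) * a ^+ 2), (vmax (alpha k)); split.
- by rewrite mulr_ge0 ?sqr_ge0.
- by move=> i; exact: vmax_ge.
- move=> i j Gji; apply: ler_pM; rewrite ?sqr_ge0 ?vmin_le //.
  have Aij : 0 < A k i j by rewrite Apos Gji.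
  have Aii : 0 < A k i i by rewrite Apos eqxx orbT.
  by rewrite expr2 ler_pM ?(ltW a0) // Age ?gt_eqF.
apply: ge_inf; last by exists k.
exists 0 => _ [j _ <-]; rewrite /ck; have := vmin0 j.+1 => ?; nonneg.
Qed.

(* Column-stochastic mixing of t is row-stochastic averaging of t / beta. *)
Lemma averaging_beta {R : realType} {n : nat} (G : nat -> rel 'I_n)
    (B : nat -> 'M[R]_n) (b : R) (beta : nat -> 'cV[R]_n) (k : nat) :
  (0 < n)%N -> 0 < b -> (forall k, strongly_connected (G k)) ->
  (forall k, col_compatible (G k) b (B k)) ->
  (forall k, stochastic_vector (beta k)) ->
  (forall k, beta k.+1 = B k *m beta k) ->
  (forall k i, 0 < beta k i 0) ->
  averaging (G k) (fun i => beta k i 0) (fun i => beta k.+1 i 0)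
    (fun i j => B k i j * beta k j 0 / beta k.+1 i 0)
    (e_inf G b beta).
Proof.
move=> n0 b0 Gc Bc betas bstep beta0; have [[B0 B1] Bpos Bge] := Bc k.
have vmin0 j : 0 <= vmin (beta j) by apply: vmin_ge => // i; exact: ltW.
have vmax0 j : 0 < vmax (beta j).
  exact: lt_le_trans (beta0 j (Ordinal n0)) (vmax_ge _ _).
have stepE i : \sum_j B k i j * beta k j 0 = beta k.+1 i 0 by rewrite bstep mxE.
split=> //.
- by case: (betas k).
- by move=> i; exact: ltW.
- by move=> i j; rewrite divr_ge0 ?mulr_ge0 ?(ltW (beta0 _ _)).
- by move=> i; rewrite -mulr_suml stepE mulfV ?gt_eqF.
- move=> j; rewrite -[RHS]mul1r -(B1 j) mulr_suml; apply: eq_bigr => i _.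
  by rewrite mulrC divfK ?gt_eqF.
(* The two entries of the rescaled matrix bring two denominators [beta k.+1 i 0]. One cancels
   against the weight [w' i]; the other gives the single [vmax (beta k.+1)] in [ek]. *)
exists (vmin (beta k) ^+ 2 * b ^+ 2 / vmax (beta k.+1)), (vmax (beta k)); split.
- by rewrite divr_ge0 ?(ltW (vmax0 _)) // mulr_ge0 ?sqr_ge0.
- by move=> i; exact: vmax_ge.
- move=> i j Gji.
  have Bij : b <= B k i j by apply: Bge; rewrite gt_eqF // Bpos Gji.
  have Bii : b <= B k i i by apply: Bge; rewrite gt_eqF // Bpos eqxx orbT.
  have -> : beta k.+1 i 0 * (B k i j * beta k j 0 / beta k.+1 i 0 *
      (B k i i * beta k i 0 / beta k.+1 i 0)) =
      (beta k j 0 * beta k i 0) * (B k i j * B k i i) / beta k.+1 i 0.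
    by field; rewrite gt_eqF.
  have v0 := vmin0 k; apply: ler_pM; first nonneg.
  - by rewrite invr_ge0 ltW.
  - apply: ler_pM; [nonneg|nonneg| |].
      by rewrite expr2; apply: ler_pM; rewrite ?vmin_le.
    by rewrite expr2; apply: ler_pM => //; exact: ltW.
  by rewrite lef_pV2 ?posrE // vmax_ge.
apply: le_trans (_ : ek G b beta k <= _).
  apply: ge_inf; last by exists k.
  by exists 0 => _ [j _ <-]; rewrite /ek; have := vmax0 j.+1 => ?; nonneg.
by rewrite /ek [vmax (beta k) ^+ 2 * _]mulrC -!mulrA invfM !mulrA.
Qed.

Lemma gamma_sup_ge {R : realType} {n : nat} (beta : nat -> 'cV[R]_n) (m : R) k i :
  0 < m -> (forall k i, m <= beta k i 0) ->
  (beta k.+1 i 0)^-1 <= gamma_sup beta.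
Proof.
move=> m0 mb; have n0 : (0 < n)%N by case: n i beta mb => [[]|].
have vm j : m <= vmin (beta j) by apply: vmin_ge.
apply: le_trans (_ : n%:R + 1 / vmin (beta k.+1) <= _).
  rewrite div1r ler_wpDl ?ler0n // lef_pV2 ?posrE ?vmin_le //.
  - exact: lt_le_trans (mb _ _).
  - exact: lt_le_trans (vm _).
apply: ub_le_sup; last by exists k.
(* The supremum requires a set bounded above, which the uniform lower bound [m] on the weights
   ensures. *)
exists (n%:R + m^-1) => _ [j _ <-].
by rewrite lerD2l div1r lef_pV2 ?posrE // (lt_le_trans m0).
Qed.

(** * One-step estimates for positions and trackers *)

Lemma sum_enorm_le_wsum {R : realType} {I : finType} {d : nat} (w : I -> R)
    (m : R) (X : I -> 'rV[R]_d) : 0 < m -> (forall i, m <= w i) ->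
  \sum_i enorm (X i) ^+ 2 <= m^-1 * \sum_i w i * enorm (X i) ^+ 2.
Proof.
move=> m0 mw; rewrite mulr_sumr; apply: ler_sum => i _.
rewrite mulrA ler_peMl ?sqr_ge0 // mulrC ler_pdivlMr // mul1r; exact: mw.
Qed.

Lemma wavg_descale {R : realType} {I : finType} {d : nat} (w : I -> R)
    (t : I -> 'rV[R]_d) : (forall i, 0 < w i) ->
  wavg w (fun i => (w i)^-1 *: t i) = \sum_i t i.
Proof.
by move=> w0; apply: eq_bigr => i _; rewrite scalerA mulfV ?gt_eqF // scale1r.
Qed.

(** The rescaled trackers have [b]-mean equal to the sum of the [t i], so their second moment is
    their variance plus the squared norm of that sum. It is applied with [w] equal to [alpha k.+1],
    where [c] is [p], and with [w] constant 1. *)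
Lemma sum_enorm_wsum_le {R : realType} {I : finType} {d : nat} (w b : I -> R)
    (c : R) (t : I -> 'rV[R]_d) :
  (forall i, 0 < b i) -> \sum_i b i = 1 -> (forall i, w i * b i <= c) ->
  \sum_i w i * enorm (t i) ^+ 2
    <= c * (wvar b (fun i => (b i)^-1 *: t i) + enorm (\sum_i t i) ^+ 2).
Proof.
move=> b0 b1 wc; rewrite -(wavg_descale b) // -wvar_second_moment // mulr_sumr.
apply: ler_sum => i _; rewrite enormZ_sqr.
have -> : w i * enorm (t i) ^+ 2
    = (w i * b i) * (b i * ((b i)^-1 ^+ 2 * enorm (t i) ^+ 2)).
  by field; rewrite gt_eqF.
by apply: ler_wpM2r => //; have := b0 i => ?; nonneg.
Qed.

Lemma objective_step {R : realType} {n d : nat} (L : R)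
    (f : 'I_n -> 'rV[R]_d -> R) (w b : 'I_n -> R) (M p eta : R)
    (x t : 'I_n -> 'rV[R]_d) (v : 'rV[R]_d) :
  (0 < n)%N -> 0 < L -> p = \sum_i w i * b i -> (forall i, smooth L (f i)) ->
  (forall i, 0 <= w i <= M) -> (forall i, 0 < b i) -> 0 < p ->
  \sum_i t i = \sum_i grad (f i) (x i) ->
  0 <= eta -> L * eta * p * n%:R <= 1 ->
  objective f (v - eta *: wavg w t) <=
    objective f v - eta * p * n%:R / 2 * enorm (grad (objective f) v) ^+ 2
    + eta * p * L ^+ 2 * (\sum_i enorm (x i - v) ^+ 2)
    + eta * M / n%:R * wvar b (fun i => (b i)^-1 *: t i).
Proof.
move=> n0 L0 pE sf wM b0 p0 tE eta0 etale.
have df y i : differentiable (f i) y by case: (sf i).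
have nR : 0 < n%:R :> R by rewrite ltr0n.
set Y := fun i => (b i)^-1 *: t i; set S := wvar b Y.
set T := \sum_i t i; set g := wavg w t; set D := grad (objective f) v.
(* [T] is the [b]-mean of [Y]; writing [t i] as [b i *: Y i] splits the direction [g] into [p *: T]
   and this correlation error. *)
pose r := wavg (fun i => w i * b i) (fun i => Y i - T).
have gE : g = p *: T + r.
  rewrite /r /wavg; under [X in _ + X]eq_bigr do rewrite scalerBr.
  rewrite sumrB -scaler_suml -pE addrC subrK; apply: eq_bigr => i _.
  by rewrite /Y scalerA mulfK ?gt_eqF.
have wb0 i : 0 <= w i * b i by rewrite mulr_ge0 ?(ltW (b0 i)) //; case/andP: (wM i).
have r_le : enorm r ^+ 2 <= p * (M * S).
  apply: le_trans (enorm_wavg_le _ _ wb0) _; rewrite -pE ler_wpM2l ?(ltW p0) //.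
  rewrite /S /wvar wavg_descale // -/T mulr_sumr; apply: ler_sum => i _.
  rewrite -mulrA; apply: ler_wpM2r; last by case/andP: (wM i).
  by have := b0 i => ?; nonneg.
have nD_T : enorm (n%:R *: D - T) ^+ 2 <= n%:R * L ^+ 2 * \sum_i enorm (x i - v) ^+ 2.
  rewrite /D grad_objective // scalerA mulfV ?gt_eqF // scale1r /T tE -enormN_sqr opprB.
  exact: (sum_grad_lipschitz L f x (fun=> v)).
apply: le_trans (descent_lemma L _ v (- (eta *: g)) L0 (smooth_objective L f n0 L0 sf)) _.
rewrite -/D.
have key : dot D (- (eta *: g)) + L / 2 * enorm (- (eta *: g)) ^+ 2
    <= - (eta * p * n%:R / 2) * enorm D ^+ 2
       + eta * p / n%:R * enorm (n%:R *: D - T) ^+ 2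
       + eta / (n%:R * p) * enorm r ^+ 2.
  rewrite gE; move: (D) (T) (r) => D' T' r'.
  rewrite enormN_sqr enormZ_sqr !enorm_sqr /dot !mulr_sumr -!big_split /=.
  apply: ler_sum => l _; rewrite !mxE -subr_ge0.
  move: (D' 0 l) (T' 0 l) (r' 0 l) => G tau rho; set N := n%:R in nR etale *.
  (* In each coordinate the slack is a combination of two squares; the step-size condition makes the
     first coefficient nonnegative. *)
  have -> : - (eta * p * N / 2) * G ^+ 2 + eta * p / N * (N * G - tau) ^+ 2
        + eta / (N * p) * rho ^+ 2
      - (G * - (eta * (p * tau + rho)) + L / 2 * (eta ^+ 2 * (p * tau + rho) ^+ 2))
    = eta * (1 - L * eta * p * N) / (2 * N * p) * (p * tau + rho) ^+ 2
      + eta * p / (2 * N) * (N * G - tau + rho / p) ^+ 2.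
    by field; rewrite !gt_eqF.
  have : 0 <= 1 - L * eta * p * N by rewrite subr_ge0.
  by move=> ?; apply: addr_ge0; nonneg.
have c1 : 0 <= eta * p / n%:R by nonneg.
have c2 : 0 <= eta / (n%:R * p) by nonneg.
have h1 := ler_wpM2l c1 nD_T; have h2 := ler_wpM2l c2 r_le.
move: h1 h2 key.
have -> : eta * p / n%:R * (n%:R * L ^+ 2 * \sum_i enorm (x i - v) ^+ 2)
   = eta * p * L ^+ 2 * \sum_i enorm (x i - v) ^+ 2 by field; rewrite gt_eqF.
have -> : eta / (n%:R * p) * (p * (M * S)) = eta * M / n%:R * S.
  by field; rewrite !gt_eqF.
by clear; lra.
Qed.

(** Old and averaged positions are both compared with the common mean [v]. By Jensen, averaging does
    not enlarge the dispersion, so each comparison costs one [wvar w x]; the factor 3 comes from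
    splitting off the tracker term. *)
Lemma displacement_le {R : realType} {I : finType} {d : nat} (e : rel I)
    (w w' : I -> R) (W : I -> I -> R) (c m eta : R) (x t : I -> 'rV[R]_d) :
  averaging e w w' W c -> 0 < m -> (forall i, m <= w i) -> (forall i, m <= w' i) ->
  \sum_i enorm (\sum_j W i j *: x j - eta *: t i - x i) ^+ 2 <=
  3 * (2 * m^-1 * wvar w x + eta ^+ 2 * \sum_i enorm (t i) ^+ 2).
Proof.
move=> avg m0 mw mw'; set v := wavg w x.
pose u i := \sum_j W i j *: x j - v.
have uE i : u i = wavg (W i) (fun j => x j - v).
  rewrite /u /wavg; under [RHS]eq_bigr do rewrite scalerBr.
  by rewrite sumrB -scaler_suml (avg_W_sum _ _ _ _ _ avg) scale1r.
have usum : \sum_i enorm (u i) ^+ 2 <= m^-1 * wvar w x.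
  apply: le_trans (sum_enorm_le_wsum w' m u m0 mw') _.
  rewrite ler_wpM2l ?invr_ge0 ?(ltW m0) //.
  rewrite -[wvar w x](averaging_mean e w w' W c (fun j => enorm (x j - v) ^+ 2) avg).
  apply: ler_sum => i _; rewrite ler_wpM2l ?(avg_w'_ge0 _ _ _ _ _ avg) // uE.
  apply: le_trans (enorm_wavg_le _ _ (avg_W_ge0 _ _ _ _ _ avg i)) _.
  by rewrite (avg_W_sum _ _ _ _ _ avg) mul1r.
have xsum : \sum_i enorm (x i - v) ^+ 2 <= m^-1 * wvar w x.
  exact: sum_enorm_le_wsum.
apply: le_trans (_ : \sum_i 3 * (enorm (u i) ^+ 2 + enorm (x i - v) ^+ 2
                                 + eta ^+ 2 * enorm (t i) ^+ 2) <= _).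
  apply: ler_sum => i _.
  have -> : \sum_j W i j *: x j - eta *: t i - x i
      = u i + - (x i - v) + - (eta *: t i).
    by rewrite /u opprB addrA subrK -!addrA; congr (_ + _); rewrite addrC.
  apply: le_trans (enormD3_le _ _ _) _.
  by rewrite !enormN_sqr enormZ_sqr.
rewrite -mulr_sumr ler_wpM2l ?ler0n // !big_split /= -mulr_sumr lerD2r.
by apply: le_trans (lerD usum xsum) _; rewrite -mulrA mulr_natl mulr2n.
Qed.

(** Conservation law of gradient tracking: the columns of [B k] sum to 1, so mixing keeps the total,
    and the gradient increments telescope from the initial gradients. *)
Lemma tracking_sum {R : realType} {n d : nat} (f : 'I_n -> 'rV[R]_d -> R)
    (G : nat -> rel 'I_n) (b : R)
    (A B : nat -> 'M[R]_n) (eta : nat -> R) (x0 : 'I_n -> 'rV[R]_d)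
    (x t : nat -> 'I_n -> 'rV[R]_d) k :
  push_pull f A B eta x0 x t -> (forall k, col_compatible (G k) b (B k)) ->
  \sum_i t k i = \sum_i grad (f i) (x k i).
Proof.
case=> x0E t0E _ tE Bc; elim: k => [|k IHk].
  by apply: eq_bigr => i _; rewrite t0E x0E.
under eq_bigr do rewrite tE.
rewrite sumrB big_split /= -IHk exchange_big /=.
have -> : \sum_j \sum_i B k i j *: t k j = \sum_j t k j.
  apply: eq_bigr => j _; rewrite -scaler_suml; have [[_ B1] _ _] := Bc k.
  by rewrite B1 scale1r.
by rewrite addrAC subrr add0r.
Qed.

Lemma consensus_error_shift {R : realType} {n d : nat} (x : 'I_n -> 'rV[R]_d)
    (v : 'rV[R]_d) : (0 < n)%N ->
  consensus_error x + enorm (average x - v) ^+ 2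
    = n%:R^-1 * \sum_i enorm (x i - v) ^+ 2.
Proof.
move=> n0; have nR : n%:R != 0 :> R by rewrite pnatr_eq0 -lt0n.
have w1 : \sum_(i < n) (n%:R^-1 : R) = 1.
  by rewrite sumr_const card_ord -[_ *+ n]mulr_natl mulfV.
have := wvar_shift (fun=> n%:R^-1) x v w1.
have -> : wavg (fun=> n%:R^-1) x = average x by rewrite /average scaler_sumr.
rewrite -mulr_sumr => ->; congr (_ + _); rewrite /wvar -mulr_sumr.
by rewrite /wavg -scaler_sumr.
Qed.

(** * What the step-size bound provides *)

(** Puts the minimum into the polynomial form used by [lyapunov_decrease]. After the signs, the
    inequalities come from the first, fifth, second, third and last of the eight numbers, in this
    order; the factors left over are absorbed by [be <= 1 <= bup] and [1 <= aup]. *)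
Lemma eta_bound_consequences {R : realType} {n : nat}
    (L al be aup bup c e g H eta : R) :
  (0 < n)%N -> 0 < L -> 0 < al -> 0 < be <= 1 -> 1 <= aup -> 1 <= bup ->
  0 <= c -> 0 < g -> 0 < eta <= H -> H <= eta_bound n L al be aup bup c e g ->
  [/\ 0 < c /\ 0 < e, L * eta * aup <= 1, 12 * eta <= e * al,
      768 * n%:R ^+ 2 * (aup * (H * g * L ^+ 2)) <= c ^+ 2 * e
    & 32 * n%:R ^+ 3 * (eta ^+ 2 * L ^+ 2) <= al * c ^+ 2 /\
      16 * n%:R ^+ 2 * (aup * eta * L ^+ 2) <= c ^+ 2].
Proof.
move=> n0 L0 al0 /andP[be0 be1] aup1 bup1 c0 g0 /andP[eta0 etaH]; rewrite /eta_bound; cbv zeta.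
set s := [:: 1 / (aup * bup * L), _ & _] => Hs; have le_s y : y \in s -> H <= y.
  move=> ys; by apply: le_trans Hs (seq_min_le _ _ ys).
have /le_s h1 : nth 0 s 0 \in s by apply: mem_nth.
have /le_s h2 : nth 0 s 1 \in s by apply: mem_nth.
have /le_s h3 : nth 0 s 2 \in s by apply: mem_nth.
have /le_s h5 : nth 0 s 4 \in s by apply: mem_nth.
have /le_s h8 : nth 0 s 7 \in s by apply: mem_nth.
move: h1 h2 h3 h5 h8; rewrite /s /= /Cs1 {s Hs le_s} => h1 h2 h3 h5 h8.
have N0 : 0 < n%:R :> R by rewrite ltr0n.
move: N0 h1 h2 h3 h5 h8; move: (n%:R : R) => N N0 h1 h2 h3 h5 h8.
have H0 : 0 < H by apply: lt_le_trans etaH.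
have aup0 : 0 < aup by apply: lt_le_trans aup1.
have bup0 : 0 < bup by apply: lt_le_trans bup1.
have L20 : 0 < L ^+ 2 by rewrite exprn_gt0.
(* If [c] were 0, the last of the eight numbers would be 0 and could not exceed the positive [H]. *)
have cp : 0 < c.
  rewrite lt_neqAle c0 andbT eq_sym; apply/eqP => c_eq0; move: h8.
  by rewrite c_eq0 mulr0 mul0r => /(lt_le_trans H0); rewrite ltxx.
(* The fifth number has the sign of [e]. *)
have ep : 0 < e.
  have : 0 < e * al * be / 12 by apply: lt_le_trans h5.
  by rewrite !pmulr_lgt0 ?invr_gt0.
have nN : N != 0 by rewrite gt_eqF.
have naup : aup != 0 by rewrite gt_eqF.
have nbup : bup != 0 by rewrite gt_eqF.
have nL : L != 0 by rewrite gt_eqF.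
have ng : g != 0 by rewrite gt_eqF.
have be16 : be <= 16 * bup by move: be1 bup1; clear; lra.
have be8 : be <= 8 * bup by move: be1 bup1; clear; lra.
split=> //.
- move: (le_trans etaH h1); rewrite ler_pdivlMr ?mulr_gt0 // => h.
  apply: le_trans h; rewrite -subr_ge0.
  have -> : eta * (aup * bup * L) - L * eta * aup = L * eta * aup * (bup - 1) by ring.
  by rewrite mulr_ge0 ?subr_ge0 // ltW // !mulr_gt0.
- move: (le_trans etaH h5); rewrite ler_pdivlMr // => h.
  rewrite mulrC; apply: le_trans h _; rewrite ger_pMr //; exact: mulr_gt0.
- move: h2; rewrite ler_pdivlMr ?mulr_gt0 // => h.
  apply: le_trans (_ : 2 * N ^+ 2 * aup *
     (be * c / (32 * aup * bup * N ^+ 3) * c * e * N) <= _).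
    apply: (le_slack (2 * N ^+ 2 * aup) _ _ _ _ _ h); first by nonneg.
    by ring.
  apply: (le_slack (c ^+ 2 * e / (16 * bup)) _ _ _ _ _ be16); first by nonneg.
  by field; rewrite nN naup nbup.
split.
- have : H ^+ 2 <= be * c / (32 * aup * bup * N ^+ 3) * c * al * be / (48 * L ^+ 2).
    rewrite -[leRHS]sqr_sqrtr; last by nonneg.
    by apply: lerXn2r h3; rewrite nnegrE ?sqrtr_ge0 ?(ltW H0).
  rewrite ler_pdivlMr ?mulr_gt0 // => h.
  have etaH2 : eta ^+ 2 <= H ^+ 2 by apply: lerXn2r etaH; rewrite nnegrE ltW.
  apply: le_trans (_ : 32 * N ^+ 3 * (H ^+ 2 * L ^+ 2) <= _).
    apply: (le_slack (32 * N ^+ 3 * L ^+ 2) _ _ _ _ _ etaH2); first by nonneg.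
    by ring.
  apply: le_trans (_ : 2 / 3 * N ^+ 3 *
      (be * c / (32 * aup * bup * N ^+ 3) * c * al * be) <= _).
    apply: (le_slack (2 / 3 * N ^+ 3) _ _ _ _ _ h); first by nonneg.
    by field; rewrite nN naup nbup.
  have be2 : be ^+ 2 <= 48 * (aup * bup).
    apply: le_trans (_ : 1 <= _); first by rewrite expr_le1 // ltW.
    by rewrite -[X in X <= _]mulr1 ler_pM ?ler1n // -[X in X <= _]mulr1 ler_pM.
  apply: (le_slack (al * c ^+ 2 / (48 * (aup * bup))) _ _ _ _ _ be2); first by nonneg.
  by field; rewrite nN naup nbup.
- move: (le_trans etaH h8); rewrite ler_pdivlMr ?mulr_gt0 // => h.
  apply: le_trans (_ : 4 * N ^+ 2 * aup *
     (be * c / (32 * aup * bup * N ^+ 3) * N * c) <= _).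
    apply: (le_slack (4 * N ^+ 2 * aup) _ _ _ _ _ h); first by nonneg.
    by ring.
  apply: (le_slack (c ^+ 2 / (8 * bup)) _ _ _ _ _ be8); first by nonneg.
  by field; rewrite nN naup nbup.
Qed.

Lemma stochastic_bounds {R : realType} {n : nat} (v : 'cV[R]_n) (lo up : R) :
  (0 < n)%N -> stochastic_vector v ->
  (forall i, lo / n%:R <= v i 0 <= up / n%:R) -> lo <= 1 <= up.
Proof.
move=> n0 [_ v1] vb; have nR : n%:R != 0 :> R by rewrite pnatr_eq0 -lt0n.
have sumE (m : R) : \sum_(i < n) m / n%:R = m.
  by rewrite sumr_const card_ord -[_ *+ n]mulr_natl mulrC divfK.
apply/andP; split; rewrite -v1.
- by rewrite -[X in X <= _]sumE; apply: ler_sum => i _; case/andP: (vb i).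
- by rewrite -[X in _ <= X]sumE; apply: ler_sum => i _; case/andP: (vb i).
Qed.

Lemma c_inf_ge0 {R : realType} {n : nat} (G : nat -> rel 'I_n) (a : R)
    (alpha : nat -> 'cV[R]_n) :
  (0 < n)%N -> (forall k i, 0 <= alpha k i 0) -> 0 <= c_inf G a alpha.
Proof.
move=> n0 alpha0; apply: lb_le_inf; first by exists (ck G a alpha 0); exists 0%N.
move=> _ [k _ <-]; have v0 : 0 <= vmin (alpha k.+1) by apply: vmin_ge.
by rewrite /ck; nonneg.
Qed.

(** * Decrease of the Lyapunov function along the algorithm *)

Lemma push_pull_decrease {R : realType} {n d : nat}
  (f : 'I_n -> 'rV[R]_d -> R) (L : R)
  (G : nat -> rel 'I_n) (A B : nat -> 'M[R]_n) (a b : R)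
  (alpha beta : nat -> 'cV[R]_n) (aup bup : R)
  (x0 : 'I_n -> 'rV[R]_d) (eta : nat -> R) (x t : nat -> 'I_n -> 'rV[R]_d) (k : nat) :
  let H := eta_up G alpha beta L a b aup bup in
  let c := c_inf G a alpha in
  let e := e_inf G b beta in
  let N := n%:R in
  let xh j := wavg (fun i => alpha j i 0) (x j) in
  let V j := wvar (fun i => alpha j i 0) (x j) in
  let S j := wvar (fun i => beta j i 0) (fun i => (beta j i 0)^-1 *: t j i) in
  let Phi j := objective f (xh j) + c / (2 * a ^+ n * N * e) * V j
               + 4 * aup * H / (N ^+ 2 * e) * S j in
  (2 <= n)%N -> 0 < L -> (forall i, smooth L (f i)) -> 0 < a -> 0 < b ->
  (forall k, strongly_connected (G k)) ->
  (forall k, row_compatible (G k) a (A k)) ->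
  (forall k, col_compatible (G k) b (B k)) ->
  (forall k, stochastic_vector (alpha k)) ->
  (forall k, stochastic_vector (beta k)) ->
  (forall k, (alpha k.+1)^T *m A k = (alpha k)^T) ->
  (forall k, beta k.+1 = B k *m beta k) ->
  (forall k i, a ^+ n / n%:R <= alpha k i 0 <= aup / n%:R) ->
  aup / n%:R <= 1 ->
  (forall k i, b ^+ n / n%:R <= beta k i 0 <= bup / n%:R) ->
  (forall k, 0 < eta k <= H) -> push_pull f A B eta x0 x t ->
  [/\ 0 < c, 0 < e &
  Phi k.+1 <= Phi k
    - eta k * a ^+ n / 4 * enorm (grad (objective f) (xh k)) ^+ 2
    - c ^+ 2 / (4 * a ^+ n * N * e) * V k].
Proof.
move=> /= n2 L0 sf a0 b0 Gc Ac Bc alphas betas astep bstep.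
move=> alphab aup_n betab etaH pp.
set H := eta_up _ _ _ _ _ _ _ _ in etaH *.
set c := c_inf _ _ _; set e := e_inf _ _ _; set N := n%:R.
set al := a ^+ n in alphab *; set be := b ^+ n in betab.
have n0 : (0 < n)%N by apply: leq_trans n2.
have nI : (1 < #|'I_n|)%N by rewrite card_ord.
have N0 : 0 < N by rewrite ltr0n.
have N1 : 1 <= N by rewrite ler1n.
have al0 : 0 < al by rewrite exprn_gt0.
have be0 : 0 < be by rewrite exprn_gt0.
have alN0 : 0 < al / N by rewrite divr_gt0.
have beN0 : 0 < be / N by rewrite divr_gt0.
have alpha_lo j i : al / N <= alpha j i 0 by case/andP: (alphab j i).
have alpha_up j i : alpha j i 0 <= aup / N by case/andP: (alphab j i).
have beta_lo j i : be / N <= beta j i 0 by case/andP: (betab j i).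
have alpha0 j i : 0 < alpha j i 0 by apply: lt_le_trans (alpha_lo j i).
have beta0 j i : 0 < beta j i 0 by apply: lt_le_trans (beta_lo j i).
have beta_sum j : \sum_i beta j i 0 = 1 by case: (betas j).
have beta_le1 j i : beta j i 0 <= 1.
  rewrite -(beta_sum j) (bigD1 i) //= lerDl.
  by apply: sumr_ge0 => l _; exact: ltW.
have /andP[al1 aup1] := stochastic_bounds _ _ _ n0 (alphas 0%N) (alphab 0%N).
have /andP[be1 bup1] := stochastic_bounds _ _ _ n0 (betas 0%N) (betab 0%N).
have aup0 : 0 < aup by apply: lt_le_trans aup1.
have gam j i : (beta j.+1 i 0)^-1 <= gamma_sup beta.
  exact: gamma_sup_ge beN0 beta_lo.
set g := gamma_sup beta in gam.
have g0 : 0 < g.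
  by apply: lt_le_trans (gam 0%N (Ordinal n0)); rewrite invr_gt0.
have cge0 : 0 <= c by apply: c_inf_ge0 => // j i; exact: ltW.
have [||[c0 e0] hL hB hA [hC hD]] := eta_bound_consequences L al be aup bup c e g H
    (eta k) n0 L0 al0 _ aup1 bup1 cge0 g0 (etaH k).
  by rewrite be0.
  by [].
have avgA := averaging_alpha G A a alpha k n0 a0 Gc Ac alphas astep alpha0.
have avgB := averaging_beta G B b beta k n0 b0 Gc Bc betas bstep beta0.
have c1 := averaging_rate_le _ _ _ _ _ avgA nI.
have e1 := averaging_rate_le _ _ _ _ _ avgB nI.
rewrite -/c in avgA c1; rewrite -/e in avgB e1.
have /andP[etak0 etakH] := etaH k.
split=> //.
set w := fun i => alpha k i 0; set w' := fun i => alpha k.+1 i 0.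
set bk := fun i => beta k i 0; set bk' := fun i => beta k.+1 i 0.
have w'0 i : 0 < w' i by exact: alpha0.
have bk0 i : 0 < bk i by exact: beta0.
have bk'0 i : 0 < bk' i by exact: beta0.
(* Effective step factor along the sum of the trackers: the weights are those of the positions after
   the step and of the trackers before it. *)
pose p := \sum_i w' i * bk i.
have p_lo : al <= p * N.
  rewrite -ler_pdivrMr // -[X in X <= _]mulr1 -(beta_sum k) mulr_sumr.
  by apply: ler_sum => i _; apply: ler_wpM2r (ltW (beta0 k i)) _ _ (alpha_lo _ i).
have p_up : p <= aup / N.
  rewrite -[X in _ <= X]mulr1 -(beta_sum k) mulr_sumr.
  by apply: ler_sum => i _; apply: ler_wpM2r (ltW (beta0 k i)) _ _ (alpha_up _ i).
have p0 : 0 < p by rewrite -(pmulr_lgt0 _ N0); apply: lt_le_trans p_lo.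
have wb_p i : w' i * bk i <= p.
  rewrite /p (bigD1 i) //= lerDl; apply: sumr_ge0 => j _.
  by rewrite mulr_ge0 ?ltW.
have [_ _ xE tE] := pp.
have tsum := tracking_sum f G b A B eta x0 x t k pp Bc.
set v := wavg w (x k); set V := wvar w (x k).
set Y := fun i => (bk i)^-1 *: t k i; set S := wvar bk Y.
pose T := enorm (\sum_i t k i) ^+ 2.
set D := enorm (grad (objective f) v) ^+ 2.
have V0 : 0 <= V by apply: wvar_ge0 => i; exact: ltW (alpha0 k i).
have S0 : 0 <= S by apply: wvar_ge0 => i; exact: ltW.
have D0 : 0 <= D by exact: sqr_ge0.
have xV : \sum_i enorm (x k i - v) ^+ 2 <= N / al * V.
  by have := sum_enorm_le_wsum w (al / N) (fun i => x k i - v) alN0 (alpha_lo k);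
    rewrite invf_div.
have xkE : x k.+1 = fun i => \sum_j A k i j *: x k j + - (eta k *: t k i).
  by apply/funext => i; rewrite xE.
have vE : wavg w' (x k.+1) = v - eta k *: wavg w' (t k).
  rewrite /v -(averaging_wavg _ _ _ _ _ (x k) avgA) xkE /wavg scaler_sumr -sumrB.
  by apply: eq_bigr => i _; rewrite scalerDr scalerN !scalerA mulrC.
have pN_aup : p * N <= aup by rewrite -ler_pdivlMr.
have hF : objective f (wavg w' (x k.+1)) <=
    objective f v - eta k * p * N / 2 * D + eta k * p * L ^+ 2 * (N / al) * V
    + eta k * aup / N ^+ 2 * S.
  rewrite vE; apply: le_trans (objective_step L f w' bk (aup / N) p (eta k) (x k) (t k) v
    n0 L0 erefl sf _ _ p0 tsum (ltW etak0) _) _.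
  - by move=> i; rewrite (ltW (alpha0 _ _)) alpha_up.
  - by move=> i; exact: beta0.
  - by apply: le_trans hL; rewrite -mulrA ler_wpM2l // mulr_ge0 // ltW.
  rewrite -/D -/S lerD //; last first.
    by rewrite le_eqVlt; apply/orP; left; apply/eqP; field; rewrite gt_eqF.
  by rewrite lerD2l -[X in _ <= X]mulrA ler_wpM2l //; nonneg.
have hV : wvar w' (x k.+1) <= (1 - c) * V + eta k ^+ 2 * p / c * (S + T).
  have := averaging_wvar _ _ _ _ _ (x k) (fun i => - (eta k *: t k i)) avgA c0 nI.
  rewrite -xkE => /le_trans; apply; rewrite lerD2l.
  under eq_bigr do rewrite enormN_sqr enormZ_sqr mulrCA.
  rewrite -mulr_sumr.
  have := sum_enorm_wsum_le w' bk p (t k) (beta0 k) (beta_sum k) wb_p.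
  rewrite -/Y -/S -/T => h.
  apply: (le_slack (eta k ^+ 2 / c) _ _ _ _ _ h); first by nonneg.
  by field; rewrite gt_eqF.
have t_le : \sum_i enorm (t k i) ^+ 2 <= S + T.
  have := sum_enorm_wsum_le (fun=> 1) bk 1 (t k) (beta0 k) (beta_sum k).
  rewrite mul1r; under eq_bigr do rewrite mul1r; apply => i.
  by rewrite mul1r; exact: beta_le1.
have dx : \sum_i enorm (x k.+1 i - x k i) ^+ 2
    <= 3 * (2 * (N / al) * V + eta k ^+ 2 * (S + T)).
  have := displacement_le _ _ _ _ _ (al / N) (eta k) (x k) (t k) avgA alN0 (alpha_lo k)
    (alpha_lo k.+1).
  rewrite invf_div xkE => /le_trans; apply.
  rewrite ler_wpM2l ?ler0n // lerD2l ler_wpM2l ?sqr_ge0 //.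
have hS : wvar bk' (fun i => (bk' i)^-1 *: t k.+1 i)
    <= (1 - e) * S + 3 * g * L ^+ 2 / e * (2 * (N / al) * V + eta k ^+ 2 * (S + T)).
  pose dg i := grad (f i) (x k.+1 i) - grad (f i) (x k i).
  (* In rescaled variables the tracker update is an averaging step perturbed by gradient
     increments. *)
  have -> : (fun i => (bk' i)^-1 *: t k.+1 i) = (fun i =>
      \sum_j (B k i j * bk j / bk' i) *: Y j + (bk' i)^-1 *: dg i).
    apply/funext => i; rewrite tE -addrA scalerDr scaler_sumr; congr (_ + _).
    apply: eq_bigr => j _; rewrite /Y !scalerA; congr (_ *: _).
    by field; rewrite !gt_eqF.
  apply: le_trans (averaging_wvar _ _ _ _ _ Y (fun i => (bk' i)^-1 *: dg i) avgB e0 nI) _.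
  rewrite lerD2l.
  have dg_le : \sum_i bk' i * enorm ((bk' i)^-1 *: dg i) ^+ 2
      <= g * L ^+ 2 * (3 * (2 * (N / al) * V + eta k ^+ 2 * (S + T))).
    apply: le_trans (_ : g * L ^+ 2 * \sum_i enorm (x k.+1 i - x k i) ^+ 2 <= _); last first.
      by rewrite ler_wpM2l //; nonneg.
    rewrite mulr_sumr; apply: ler_sum => i _; rewrite enormZ_sqr -mulrA.
    have -> : bk' i * ((bk' i)^-1 ^+ 2 * enorm (dg i) ^+ 2)
        = (bk' i)^-1 * enorm (dg i) ^+ 2 by field; rewrite gt_eqF.
    by apply: ler_pM; rewrite ?invr_ge0 ?sqr_ge0 ?(ltW (beta0 _ _)) //;
      [exact: gam | exact: smooth_sqr].
  apply: (le_slack e^-1 _ _ _ _ _ dg_le); first by rewrite invr_ge0 ltW.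
  by field; rewrite !gt_eqF.
have hT : T <= 2 * N ^+ 2 * D + 2 * L ^+ 2 * N * (N / al) * V.
  have df y i : differentiable (f i) y by case: (sf i).
  (* The trackers sum to the gradients at the individual points; replacing these points by [v] costs
     a multiple of [V]. *)
  have -> : T = enorm (N *: grad (objective f) v
      + (\sum_i grad (f i) (x k i) - \sum_i grad (f i) v)) ^+ 2.
    rewrite /T tsum grad_objective // scalerA mulfV ?gt_eqF // scale1r.
    by rewrite addrC subrK.
  apply: le_trans (enormD_le _ _) _; rewrite enormZ_sqr -/D.
  have := sum_grad_lipschitz L f (x k) (fun=> v) sf; set Q := enorm _ ^+ 2 => hQ.
  have hQ2 : Q <= N * L ^+ 2 * (N / al * V).
    by apply: le_trans hQ _; rewrite ler_wpM2l //; nonneg.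
  rewrite mulrDr mulrA lerD2l.
  apply: (le_slack 2 _ _ _ _ _ hQ2); first by [].
  by ring.
have := lyapunov_decrease N al aup L c e g H (eta k) p _ _ _ _ _ _ _ _
  N1 al0 aup0 _ _ _ _ _ (ltW g0) V0 S0 D0 hB hA hC hD hF hV hS hT.
move=> dec; apply: le_trans (dec _ _ _ _ _) _.
- by rewrite c0 /=; apply: le_trans c1 _; lra.
- by rewrite e0 /=; apply: le_trans e1 _; lra.
- by rewrite (ltW etak0).
- by rewrite p_lo.
- by rewrite (ltW p0) /=; apply: le_trans p_up _.
(* The factor [p * N], which varies with [k], is weakened to its uniform lower bound [al]. *)
rewrite lerD2r lerD2l lerN2 ler_wpM2r //.
apply: (le_slack (eta k / 4) _ _ _ _ _ p_lo); first by nonneg.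
by field.
Qed.

(** * Summation over the steps and the rate *)

Lemma telescope_sum_le {R : realType} (Phi u : nat -> R) (m : R) :
  (forall k, Phi k.+1 <= Phi k - u k) -> (forall k, m <= Phi k) ->
  forall K, \sum_(k < K) u k <= Phi 0%N - m.
Proof.
move=> dec lb K; apply: le_trans (_ : Phi 0%N - Phi K <= _); last by rewrite lerD2l lerN2.
elim: K => [|K IHK]; first by rewrite big_ord0 subrr.
by rewrite big_ord_recr /=; have := dec K; lra.
Qed.

Lemma push_pull_summable {R : realType} {n d : nat}
  (f : 'I_n -> 'rV[R]_d -> R) (L : R)
  (G : nat -> rel 'I_n) (A B : nat -> 'M[R]_n) (a b : R)
  (alpha beta : nat -> 'cV[R]_n) (aup bup : R)
  (x0 : 'I_n -> 'rV[R]_d) (eta_low : R) :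
  let H := eta_up G alpha beta L a b aup bup in
  (2 <= n)%N -> 0 < L -> (forall i, bounded_below (f i)) ->
  (forall i, smooth L (f i)) -> 0 < a -> 0 < b ->
  (forall k, strongly_connected (G k)) ->
  (forall k, row_compatible (G k) a (A k)) ->
  (forall k, col_compatible (G k) b (B k)) ->
  (forall k, stochastic_vector (alpha k)) ->
  (forall k, stochastic_vector (beta k)) ->
  (forall k, (alpha k.+1)^T *m A k = (alpha k)^T) ->
  (forall k, beta k.+1 = B k *m beta k) ->
  (forall k i, a ^+ n / n%:R <= alpha k i 0 <= aup / n%:R) ->
  aup / n%:R <= 1 ->
  (forall k i, b ^+ n / n%:R <= beta k i 0 <= bup / n%:R) ->
  0 < eta_low <= H ->
  exists2 C : R, 0 <= C & forall (eta : nat -> R),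
    (forall k, eta_low <= eta k <= H) ->
    forall (x t : nat -> 'I_n -> 'rV[R]_d), push_pull f A B eta x0 x t ->
    forall K : nat,
      \sum_(k < K) enorm (grad (objective f) (average (x k))) ^+ 2 <= C /\
      \sum_(k < K) consensus_error (x k) <= C.
Proof.
move=> /= n2 L0 fb sf a0 b0 Gc Ac Bc alphas betas astep bstep.
move=> alphab aup_n betab /andP[low0 lowH].
set H := eta_up _ _ _ _ _ _ _ _ in lowH *.
have [m mF] := bounded_below_objective f fb.
have n0 : (0 < n)%N by apply: leq_trans n2.
have N0 : 0 < n%:R :> R by rewrite ltr0n.
set c := c_inf G a alpha; set e := e_inf G b beta; set al := a ^+ n in alphab *.
pose p1 := c / (2 * al * n%:R * e).
pose p2 := 4 * aup * H / (n%:R ^+ 2 * e).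
pose xh (y : 'I_n -> 'rV[R]_d) j := wavg (fun i => alpha j i 0) y.
pose V (y : 'I_n -> 'rV[R]_d) j := wvar (fun i => alpha j i 0) y.
pose S (t : 'I_n -> 'rV[R]_d) j :=
  wvar (fun i => beta j i 0) (fun i => (beta j i 0)^-1 *: t i).
pose Phi y t j := objective f (xh y j) + p1 * V y j + p2 * S t j.
(* The initial trackers are the gradients at [x0], so [Delta] is fixed before the step sizes are
   chosen, and so is [C]. *)
pose Delta := Phi x0 (fun i => grad (f i) (x0 i)) 0%N - m.
pose k1 := eta_low * al / 4; pose k2 := c ^+ 2 / (4 * al * n%:R * e).
(* The first two terms bound the gradients at the plain averages, the third the consensus errors. *)
pose C := 2 / k1 * Delta + 2 * L ^+ 2 / (al * k2) * Delta + 1 / (al * k2) * Delta.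
have al0 : 0 < al by rewrite exprn_gt0.
have alN0 : 0 < al / n%:R by rewrite divr_gt0.
have H0 : 0 < H by apply: lt_le_trans lowH.
have aup0 : 0 < aup.
  have /andP[_ aup1] := stochastic_bounds _ _ _ n0 (alphas 0%N) (alphab 0%N).
  exact: lt_le_trans aup1.
have alpha_lo j i : al / n%:R <= alpha j i 0 by case/andP: (alphab j i).
have alpha0 j i : 0 <= alpha j i 0 by apply: le_trans (alpha_lo j i); exact: ltW.
have beta0 j i : 0 <= beta j i 0.
  by case/andP: (betab j i) => + _; apply: le_trans; rewrite divr_ge0 ?exprn_ge0 ?ltW.
have V0 y j : 0 <= V y j by exact: wvar_ge0.
have S0 y j : 0 <= S y j by exact: wvar_ge0.
have sum_le (eta : nat -> R) x t : (forall k, eta_low <= eta k <= H) ->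
    push_pull f A B eta x0 x t ->
    [/\ 0 < k2, 0 <= Delta & forall K,
     k1 * (\sum_(k < K) enorm (grad (objective f) (xh (x k) k)) ^+ 2) <= Delta /\
     k2 * (\sum_(k < K) V (x k) k) <= Delta].
  move=> etaH pp.
  have etaH' k : 0 < eta k <= H.
    by have /andP[l ->] := etaH k; rewrite (lt_le_trans low0 l).
  have dec k := push_pull_decrease f L G A B a b alpha beta aup bup x0 eta x t k
    n2 L0 sf a0 b0 Gc Ac Bc alphas betas astep bstep alphab aup_n betab etaH' pp.
  have [c0 e0 _] := dec 0%N; rewrite -/c in c0; rewrite -/e in e0.
  have k20 : 0 < k2 by rewrite /k2 divr_gt0 ?exprn_gt0 // !mulr_gt0.
  have p10 : 0 <= p1 by rewrite /p1; nonneg.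
  have p20 : 0 <= p2 by rewrite /p2; nonneg.
  have Phi_ge y s j : m <= Phi y s j.
    by rewrite /Phi -addrA ler_wpDr // addr_ge0 // mulr_ge0.
  pose u k := k1 * enorm (grad (objective f) (xh (x k) k)) ^+ 2 + k2 * V (x k) k.
  have uP : forall K, \sum_(k < K) u k <= Delta.
    have [x0E t0E _ _] := pp.
    have -> : Delta = Phi (x 0%N) (t 0%N) 0%N - m.
      have -> : t 0%N = fun i => grad (f i) (x0 i) by apply/funext => i; rewrite t0E.
      by have -> : x 0%N = x0 by apply/funext => i; rewrite x0E.
    apply: (telescope_sum_le (fun k => Phi (x k) (t k) k)) => // k.
    have [_ _ deck] := dec k; apply: le_trans deck _.
    rewrite -/H -/c -/e -/al -/p1 -/p2 -/(xh (x k) k) -/(V (x k) k) -/(S (t k) k).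
    rewrite -/(Phi (x k) (t k) k) -/k2 /u opprD addrA lerD2r lerD2l lerN2.
    rewrite ler_wpM2r ?sqr_ge0 // /k1 ler_wpM2r ?invr_ge0 ?ler0n // ler_wpM2r ?(ltW al0) //.
    by case/andP: (etaH k).
  have k10 : 0 <= k1 by rewrite /k1; nonneg.
  split=> // [|K]; first by rewrite subr_ge0.
  have := uP K; rewrite big_split /= -!mulr_sumr.
  have : 0 <= k1 * \sum_(k < K) enorm (grad (objective f) (xh (x k) k)) ^+ 2.
    by rewrite mulr_ge0 // sumr_ge0 // => k _; exact: sqr_ge0.
  have : 0 <= k2 * \sum_(k < K) V (x k) k by rewrite mulr_ge0 ?(ltW k20) // sumr_ge0.
  by clear; lra.
have k10 : 0 < k1 by rewrite /k1 divr_gt0 // mulr_gt0.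
(* The signs of [k2] and [Delta] are supplied by [sum_le] once a run is given; the absolute value
   makes the witness nonnegative before that. *)
exists (`|C|) => // eta etaH x t pp K.
have [k20 Delta0 /(_ K) [sumG sumV]] := sum_le eta x t etaH pp.
have -> : `|C| = C by rewrite ger0_norm // /C !addr_ge0 //; nonneg.
(* Dropping one summand on the left bounds the consensus error; dropping the other bounds the
   distance between the plain and the weighted mean. *)
have consE k : consensus_error (x k) + enorm (average (x k) - xh (x k) k) ^+ 2
    <= V (x k) k / al.
  rewrite consensus_error_shift //.
  have := sum_enorm_le_wsum _ _ (fun i => x k i - xh (x k) k) alN0 (alpha_lo k).
  move=> h; apply: (le_slack n%:R^-1 _ _ _ _ _ h); first by rewrite invr_ge0 ltW.
  by rewrite /V /wvar; field; rewrite !gt_eqF.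
have cons0 k : 0 <= consensus_error (x k).
  rewrite /consensus_error mulr_ge0 ?invr_ge0 ?ler0n // sumr_ge0 // => i _.
  exact: sqr_ge0.
have gradE k : enorm (grad (objective f) (average (x k))) ^+ 2 <=
    2 * enorm (grad (objective f) (xh (x k) k)) ^+ 2 + 2 * L ^+ 2 / al * V (x k) k.
  have := smooth_sqr L (objective f) (average (x k)) (xh (x k) k)
    (smooth_objective L f n0 L0 sf).
  set Dx := enorm (average _ - _) ^+ 2 => hlip.
  have hD : L ^+ 2 * Dx <= L ^+ 2 * (V (x k) k / al).
    by rewrite ler_wpM2l ?sqr_ge0 // (le_trans _ (consE k)) // lerDr.
  rewrite -[grad _ (average _)](subrK (grad (objective f) (xh (x k) k))).
  apply: le_trans (enormD_le _ _) _; rewrite mulrDr addrC lerD2l.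
  apply: (le_slack 2 _ _ _ _ _ (le_trans hlip hD)); first by [].
  by field; rewrite gt_eqF.
have sG : \sum_(k < K) enorm (grad (objective f) (xh (x k) k)) ^+ 2 <= Delta / k1.
  by rewrite ler_pdivlMr // mulrC.
have sV : \sum_(k < K) V (x k) k <= Delta / k2 by rewrite ler_pdivlMr // mulrC.
have d1 : 0 <= 2 / k1 * Delta by nonneg.
have d2 : 0 <= 2 * L ^+ 2 / (al * k2) * Delta by nonneg.
have d3 : 0 <= 1 / (al * k2) * Delta by nonneg.
split.
- apply: le_trans (_ : \sum_(k < K) (2 * enorm (grad (objective f) (xh (x k) k)) ^+ 2
      + 2 * L ^+ 2 / al * V (x k) k) <= _); first by apply: ler_sum => k _.
  rewrite big_split /= -!mulr_sumr /C.
  apply: ler_wpDr => //; apply: lerD.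
    by apply: (le_slack 2 _ _ _ _ _ sG) => //; ring.
  apply: (le_slack (2 * L ^+ 2 / al) _ _ _ _ _ sV); first by nonneg.
  by field; rewrite !gt_eqF.
- apply: le_trans (_ : \sum_(k < K) V (x k) k / al <= _).
    apply: ler_sum => k _; apply: le_trans (consE k).
    by rewrite lerDl sqr_ge0.
  rewrite -mulr_suml /C; apply: ler_wpDl; first exact: addr_ge0.
  apply: (le_slack al^-1 _ _ _ _ _ sV); first by rewrite invr_ge0 ltW.
  by field; rewrite !gt_eqF.
Qed.

Theorem theorem3p6 (R : realType) (n d : nat) (n_ge2 : (2 <= n)%N)
  (f : 'I_n -> 'rV[R]_d -> R) (L : R) (L_gt0 : 0 < L)
  (f_bounded : forall i, bounded_below (f i))
  (f_smooth : forall i, smooth L (f i))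
  (G : nat -> rel 'I_n) (A B : nat -> 'M[R]_n) (a b : R)
  (a_gt0 : 0 < a) (b_gt0 : 0 < b)
  (G_connected : forall k, strongly_connected (G k))
  (A_compatible : forall k, row_compatible (G k) a (A k))
  (B_compatible : forall k, col_compatible (G k) b (B k))
  (alpha beta : nat -> 'cV[R]_n) (aup bup : R)
  (alpha_stochastic : forall k, stochastic_vector (alpha k))
  (beta_stochastic : forall k, stochastic_vector (beta k))
  (alpha_step : forall k, (alpha k.+1)^T *m A k = (alpha k)^T)
  (beta_step : forall k, beta k.+1 = B k *m beta k)
  (alpha_bounds : forall k i, a ^+ n / n%:R <= alpha k i 0 <= aup / n%:R)
  (aup_le : aup / n%:R <= 1)
  (beta_bounds : forall k i, b ^+ n / n%:R <= beta k i 0 <= bup / n%:R)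
  (bup_le : bup / n%:R <= 1)
  (x0 : 'I_n -> 'rV[R]_d) (eta_low : R) (eta_low_gt0 : 0 < eta_low) :
  exists2 C : R, 0 < C &
    forall (eta : nat -> R),
      (forall k, eta_low <= eta k <= eta_up G alpha beta L a b aup bup) ->
    forall (x t : nat -> 'I_n -> 'rV[R]_d), push_pull f A B eta x0 x t ->
    forall K : nat, (2 <= K)%N ->
      seq_min [seq enorm (grad (objective f) (average (x k))) ^+ 2
              | k <- iota 0 K.-1]
        <= C * (a * b) ^- n * K%:R^-1
      /\
      seq_min [seq consensus_error (x k) | k <- iota 0 K.-1]
        <= C * (a * b) ^- n * K%:R^-1.
Proof.
have n0 : (0 < n)%N by apply: leq_trans n_ge2.
have ab0 : 0 < (a * b) ^+ n by rewrite exprn_gt0 // mulr_gt0.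
(* If [eta_low] exceeds the bound, no step-size sequence is admissible and any positive constant
   will do. *)
have [lowH|Hlow] := leP eta_low (eta_up G alpha beta L a b aup bup); last first.
  exists 1 => // eta etaH; have /andP[h1 h2] := etaH 0%N.
  by have := lt_le_trans Hlow (le_trans h1 h2); rewrite ltxx.
have [|C C0 sumC] := push_pull_summable f L G A B a b alpha beta aup bup x0 eta_low
  n_ge2 L_gt0 f_bounded f_smooth a_gt0 b_gt0 G_connected A_compatible B_compatible
  alpha_stochastic beta_stochastic alpha_step beta_step alpha_bounds aup_le beta_bounds.
  by rewrite eta_low_gt0.
(* The power of [a * b] cancels the one in the claim, the 2 comes from [seq_min_rate], and the added
   1 makes the constant strictly positive. *)
exists ((2 * C + 1) * (a * b) ^+ n); first by rewrite mulr_gt0 // ltr_wpDl // mulr_ge0.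
move=> eta etaH x t pp K K2; have [sG sE] := sumC eta etaH x t pp K.-1.
rewrite mulfK ?gt_eqF //.
have weaken (y : R) : y <= 2 * C * K%:R^-1 -> y <= (2 * C + 1) * K%:R^-1.
  by move=> yC; apply: le_trans yC _; rewrite ler_wpM2r ?invr_ge0 ?ler0n // lerDl.
by split; apply: weaken; apply: seq_min_rate.
Qed.
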